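(* Let $s\in\mathbb{N}$, $S=\{1,\dots,s\}$, and let $\alpha\in\mathbb{N}\cup\{\infty\}$ with $\alpha\ge2$. Assume that the mixed partial derivatives of $f$ up to order $\alpha$ in each variable $x_i$ are continuous on $[0,1]^s$, and let $1\le p\le\infty$. Let $\emptyset\neq v\subset S$. Then for every $\mathbf{k}_v\in\mathbb{N}^{|v|}$, $$|\hat f((\mathbf{k}_v;\mathbf{0}))|\le 2^{|v|/p}\cdot 2^{-\mu'_\alpha(\mathbf{k}_v)}\cdot\|f^{(\min(\alpha,\mathbf{N}_{\mathbf{k}_v}))}\|_p .$$
   Context: $\mathbb{N}$ denotes the positive integers, $\mathbb{N}_0=\mathbb{N}\cup\{0\}$. Walsh functions and coefficients: for $\mathbf{k}=(k_1,\dots,k_s)\in\mathbb{N}_0^s$, $\mathrm{wal}_{\mathbf{k}}(\mathbf{x})=\prod_{i=1}^s(-1)^{\sum_{j\ge1}\kappa_{i,j}b_{i,j}}$, where $k_i=\sum_{j\ge1}\kappa_{i,j}2^{j-1}$ and $x_i=\sum_{j\ge1}b_{i,j}2^{-j}$ are binary expansions, and for each $i$ infinitely many digits $b_{i,j}$ are $0$. $\hat f(\mathbf{k})=\int_{[0,1)^s}f(\mathbf{x})\,\mathrm{wal}_{\mathbf{k}}(\mathbf{x})\,d\mathbf{x}$. For $\mathbf{k}_v\in\mathbb{N}^{|v|}$ (indexed by $v$), $(\mathbf{k}_v;\mathbf{0})\in\mathbb{N}_0^s$ has $j$th component $k_j$ if $j\in v$ and $0$ otherwise. For $\mathbf{l}=(l_1,\dots,l_{|v|})\in\mathbb{N}^{|v|}$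 with dyadic expansions $l_i=\sum_{j=1}^{N_i}2^{a_{i,j}}$, $a_{i,1}>\cdots>a_{i,N_i}\ge0$: $\mu'_\alpha(\mathbf{l})=\sum_{i=1}^{|v|}\sum_{j=1}^{\min(\alpha,N_i)}(a_{i,j}+2)$ and $\min(\alpha,\mathbf{N}_{\mathbf{l}})=(\min(\alpha,N_1),\dots,\min(\alpha,N_{|v|}))$. Norm: for $\alpha_v=(\alpha_i)_{i\in v}$, $\|f^{(\alpha_v)}\|_p=\Big(\int_{[0,1)^{|v|}}\Big|\int_{[0,1)^{|S\setminus v|}}\frac{\partial^{|\alpha_v|}f}{\partial\mathbf{x}_{\alpha_v}}\,d\mathbf{x}_{S\setminus v}\Big|^p d\mathbf{x}_v\Big)^{1/p}$, where $\partial^{|\alpha_v|}f/\partial\mathbf{x}_{\alpha_v}$ is the mixed partial derivative of order $\alpha_i$ in $x_i$ for $i\in v$ and order $0$ in the other variables (essential supremum over $\mathbf{x}_v$ if $p=\infty$, and $1/\infty=0$). ''Mixed partial derivatives up to order $\alpha$ in each variable are continuous'' means that $\partial^{n_1+\cdots+n_s}f/\partial x_1^{n_1}\cdots\partial x_s^{n_s}$ exists and is continuous on $[0,1]^s$ for all integers $0\le n_i\le\alpha$ (all $n_i\in\mathbb{N}_0$ if $\alpha=\infty$). *)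

(* Defs.v *)
From HB Require Import structures.
From mathcomp Require Import all_boot all_order all_algebra.
From mathcomp Require Import all_classical all_reals all_analysis.
From mathcomp Require Import zify.

Set Implicit Arguments.
Unset Strict Implicit.
Unset Printing Implicit Defensive.

Import Order.TTheory GRing.Theory Num.Theory.
Import numFieldNormedType.Exports.

Local Open Scope classical_set_scope.
Local Open Scope ring_scope.

(* Lebesgue measure on R^n, as the n-fold product of the Lebesgue measure on R,
   on the product sigma-algebra that MathComp-Analysis puts on n-tuples. *)
Section lebesgue_tuple.
Context {R : realType}.
Local Notation RT := (measurableTypeR R).

Definition cons_pair n (x : RT * n.-tuple RT) : n.+1.-tuple RT :=
  [tuple of x.1 :: x.2].

Definition uncons_tuple n (x : n.+1.-tuple RT) : RT * n.-tuple RT :=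
  (thead x, [tuple of behead x]).

Lemma measurable_cons_pair n : measurable_fun setT (@cons_pair n).
Proof. exact: measurable_cons. Qed.

Lemma measurable_uncons_tuple n : measurable_fun setT (@uncons_tuple n).
Proof.
apply/measurable_fun_pairP; split; first exact: (measurable_tnth ord0).
exact: measurable_behead.
Qed.

Lemma cons_pairK n : cancel (@cons_pair n) (@uncons_tuple n).
Proof.
by case=> a t; rewrite /uncons_tuple /=; congr pair => //; exact: val_inj.
Qed.

Lemma uncons_tupleK n : cancel (@uncons_tuple n) (@cons_pair n).
Proof. by move=> t; rewrite /cons_pair /= -tuple_eta. Qed.

(* The sigma-finite instance of the library on m1 \x m2 is shadowed by the one
   for products of subprobabilities. *)
Lemma sigma_finite_lebesgue_prod n
    (m : {sigma_finite_measure set (n.-tuple RT) -> \bar R}) :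
  sigma_finite setT (lebesgue_measure \x m)%E.
Proof.
have /sigma_finiteP[F [TF ndF Foo]] := sigma_finiteT (@lebesgue_measure R).
have /sigma_finiteP[G [TG ndG Goo]] := sigma_finiteT m.
exists (fun i => F i `*` G i).
  rewrite -setXTT TF TG predeqE => -[x y]; split.
    move=> [/= [i _ Fix] [j _ Gjy]]; exists (maxn i j) => //; split.
    - by move: x Fix; exact/subsetPset/ndF/leq_maxl.
    - by move: y Gjy; exact/subsetPset/ndG/leq_maxr.
  by move=> [i _ []/= ? ?]; split; exists i.
move=> i; have [? ?] := Foo i; have [? ?] := Goo i.
split; first exact: measurableX.
by rewrite product_measure1E// lte_mul_pinfty// ge0_fin_numE.
Qed.

Section step.
Context (n : nat) (m : {sigma_finite_measure set (n.-tuple RT) -> \bar R}).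

Definition lebesgue_cons : set (n.+1.-tuple RT) -> \bar R :=
  pushforward (lebesgue_measure \x m)%E (@cons_pair n).

Let lebesgue_cons0 : lebesgue_cons set0 = 0%E.
Proof. by rewrite /lebesgue_cons /pushforward preimage_set0 measure0. Qed.

Let mpre A : measurable A -> measurable (@cons_pair n @^-1` A).
Proof.
by move=> mA; rewrite -[X in measurable X]setTI; exact: measurable_cons_pair.
Qed.

Let lebesgue_cons_ge0 A : (0 <= lebesgue_cons A)%E.
Proof. exact: (measure_ge0 (lebesgue_measure \x m)%E). Qed.

Let lebesgue_cons_sigma_additive : semi_sigma_additive lebesgue_cons.
Proof.
move=> F mF tF mUF; rewrite /lebesgue_cons /pushforward preimage_bigcup.
apply: measure_semi_sigma_additive.
- by move=> i; exact: mpre.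
- apply/trivIsetP => /= i j _ _ ij; rewrite -preimage_setI.
  by move/trivIsetP : tF => /(_ _ _ _ _ ij) ->//; rewrite preimage_set0.
- by rewrite -preimage_bigcup; exact: mpre.
Qed.

HB.instance Definition _ := isMeasure.Build _ _ _ lebesgue_cons
  lebesgue_cons0 lebesgue_cons_ge0 lebesgue_cons_sigma_additive.

Let lebesgue_cons_sigma_finite : sigma_finite setT lebesgue_cons.
Proof.
have [F TF Foo] := sigma_finite_lebesgue_prod m.
exists (fun i => @uncons_tuple n @^-1` F i).
  by rewrite -preimage_bigcup -TF preimage_setT.
move=> i; have [mF Fi] := Foo i; split.
  by rewrite -[X in measurable X]setTI; exact: measurable_uncons_tuple.
rewrite /lebesgue_cons /pushforward -comp_preimage.
rewrite (_ : _ \o _ = idfun) ?preimage_id//.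
by apply/funext => x; exact: cons_pairK.
Qed.

HB.instance Definition _ := Measure_isSigmaFinite.Build _ _ _ lebesgue_cons
  lebesgue_cons_sigma_finite.

End step.

Fixpoint lebesgue_tuple (n : nat) :
    {sigma_finite_measure set (n.-tuple RT) -> \bar R} :=
  if n is m.+1 then lebesgue_cons (lebesgue_tuple m)
  else \d_ ([tuple] : 0.-tuple RT).

End lebesgue_tuple.

Section cubes.
Context {R : realType}.

(* [0,1)^n, as a set of tuples: the domain of integration. *)
Definition unit_cube n : set (n.-tuple (measurableTypeR R)) :=
  [set x | forall i, 0 <= tnth x i < 1].

(* [0,1]^n, as a set of row vectors, which carry the topology of R^n. *)
Definition closed_cube n : set 'rV[R]_n :=
  [set x | forall i, 0 <= x ord0 i <= 1].

Definition row_of_tuple n (x : n.-tuple R) : 'rV[R]_n :=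
  \row_i tnth x i.

End cubes.

(* Vectors indexed by v \subset S are #|v|-tuples, listed in the increasing
   order of the indices (which is the order of enum v). *)
Section indexed_by_subset.
Context {s : nat} (v : {set 'I_s}).

(* The point of R^s with v-coordinates y and (S \ v)-coordinates z. *)
Definition glue (R : nmodType) (y : #|v|.-tuple R) (z : #|~: v|.-tuple R) :
    s.-tuple R :=
  [tuple if i \in v then y`_(index i (enum v))
         else z`_(index i (enum (~: v))) | i < s].

(* (k_v; 0) *)
Definition extend0 (k : #|v|.-tuple nat) : s.-tuple nat :=
  [tuple if i \in v then nth 0%N k (index i (enum v)) else 0%N | i < s].

End indexed_by_subset.

Section dyadic.

(* The exponents a_1 > ... > a_N in l = 2^a_1 + ... + 2^a_N. *)
Definition exponents (l : nat) : seq nat :=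
  [seq a <- rev (iota 0 l) | odd (l %/ 2 ^ a)].

Lemma exponents_sorted l : sorted gtn (exponents l).
Proof.
apply: sorted_filter; first by move=> y x z /= xy yz; exact: ltn_trans yz xy.
by rewrite rev_sorted; exact: iota_ltn_sorted.
Qed.

Lemma exponents_sum l : (\sum_(a <- exponents l) 2 ^ a)%N = l.
Proof.
have H m : (\sum_(a <- iota 0 m) odd (l %/ 2 ^ a) * 2 ^ a = l %% 2 ^ m)%N.
  elim: m => [|m IH]; first by rewrite big_nil modn1.
  rewrite -addn1 iotaD big_cat big_seq1 /= add0n IH addn1.
  set q := (l %/ 2 ^ m)%N; set r := (l %% 2 ^ m)%N.
  have {1}-> : l = (q./2 * 2 ^ m.+1 + (r + odd q * 2 ^ m))%N.
    rewrite [LHS](divn_eq l (2 ^ m)) -/q -/r -{1}(odd_double_half q).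
    by rewrite mulnDl -muln2 -mulnA -expnS; lia.
  rewrite modnMDl modn_small// expnS mul2n -addnn -addSn leq_add//.
    by rewrite ltn_mod expn_gt0.
  by case: odd; rewrite ?mul1n.
rewrite big_filter big_mkcond /= (perm_big (iota 0 l)) ?perm_rev//=.
transitivity (l %% 2 ^ l)%N; last by rewrite modn_small// ltn_expl.
rewrite -(H l); apply: eq_bigr => a _.
by case: odd; rewrite ?mul1n.
Qed.

(* alpha ranges over N \cup {oo}; None stands for oo. *)
Definition le_alpha (n : nat) (alpha : option nat) : bool :=
  if alpha is Some a then (n <= a)%N else true.

Definition min_alpha (alpha : option nat) (n : nat) : nat :=
  if alpha is Some a then minn a n else n.

Definition min_alphaN (alpha : option nat) n (l : n.-tuple nat) :
    n.-tuple nat :=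
  [tuple min_alpha alpha (size (exponents (tnth l i))) | i < n].

Definition mu' (alpha : option nat) n (l : n.-tuple nat) : nat :=
  (\sum_(i < n)
    \sum_(a <- take (tnth (min_alphaN alpha l) i) (exponents (tnth l i)))
      (a + 2))%N.

End dyadic.

Section walsh.
Context {R : realType}.

(* b j is the (j+1)-th binary digit of x. *)
Definition is_binary_expansion (x : R) (b : nat -> bool) : Prop :=
  series (fun j => (b j)%:R * 2 ^- j.+1) @ \oo --> x
  /\ forall m : nat, exists2 j, (m <= j)%N & b j = false.

(* Such an expansion exists and is unique for 0 <= x < 1. *)
Definition binary_digits (x : R) : nat -> bool :=
  xget (fun=> false) [set b | is_binary_expansion x b].

(* odd (k %/ 2 ^ j) is the coefficient of 2 ^ j in k; it is 0 for j >= k. *)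
Definition walsh1 (k : nat) (x : R) : R :=
  (-1) ^+ (\sum_(j < k) odd (k %/ 2 ^ j) * binary_digits x j)%N.

Definition walsh s (k : s.-tuple nat) (x : s.-tuple R) : R :=
  \prod_(i < s) walsh1 (tnth k i) (tnth x i).

Definition walsh_coef s (f : 'rV[R]_s -> R) (k : s.-tuple nat) : R :=
  \int[lebesgue_tuple s]_(x in @unit_cube R s)
    (f (row_of_tuple x) * walsh k x).

End walsh.

(* Partial derivatives of functions on [0,1]^s: one-sided on the faces of the
   cube, so that they only depend on the values of the function on the cube. *)
Section partial_derivatives.
Context {R : realType} {s : nat}.
Implicit Types (f : 'rV[R]_s -> R) (x : 'rV[R]_s) (i : 'I_s).

Definition set_coord x i (t : R) : 'rV[R]_s :=
  \row_j if j == i then t else x ord0 j.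

Definition diff_quotient i f x (t : R) : R :=
  (f (set_coord x i t) - f x) / (t - x ord0 i).

Definition partial_filter i x : set_system R :=
  within `[0, 1] (x ord0 i)^'.

Definition has_partial i f : Prop :=
  forall x, closed_cube x ->
    cvg (diff_quotient i f x t @[t --> partial_filter i x]).

Definition partial i f : 'rV[R]_s -> R :=
  fun x => lim (diff_quotient i f x t @[t --> partial_filter i x]).

(* d^(n_1+...+n_s) / dx_1^n_1 ... dx_s^n_s as the list of the successive
   variables, the head being the outermost derivative. *)
Definition diff_vars (n : s.-tuple nat) : seq 'I_s :=
  flatten [seq nseq (tnth n i) i | i <- enum 'I_s].

Definition mixed_partial (n : s.-tuple nat) f : 'rV[R]_s -> R :=
  foldr partial f (diff_vars n).

Fixpoint has_partials (w : seq 'I_s) f : Prop :=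
  if w is i :: w' then has_partials w' f /\ has_partial i (foldr partial f w')
  else True.

Definition has_mixed_partial (n : s.-tuple nat) f : Prop :=
  has_partials (diff_vars n) f.

Definition continuous_mixed_partials (alpha : option nat) f : Prop :=
  forall n : s.-tuple nat, (forall i, le_alpha (tnth n i) alpha) ->
    has_mixed_partial n f /\
    {within @closed_cube R s, continuous (mixed_partial n f)}.

End partial_derivatives.

(* || f^(a_v) ||_p, the L^p norm over [0,1)^|v| being that over R^|v| of the
   extension by 0. *)
Definition deriv_norm (R : realType) s (v : {set 'I_s}) (a : #|v|.-tuple nat)
    (p : \bar R) (f : 'rV[R]_s -> R) : \bar R :=
  Lnorm (lebesgue_tuple #|v|) p
    ((fun y => (\int[lebesgue_tuple #|~: v|]_(z in @unit_cube R #|~: v|)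
                  mixed_partial (extend0 a) f (row_of_tuple (glue y z)))%:E)
     \_ (@unit_cube R #|v|)).

(* Main.v *)
(* Flipping the binary digit [a] preserves Lebesgue measure on [0,1) and changes
   the sign of the Rademacher function of index [a], so integrating [F] against
   that function only involves the differences of [F] between [x] and its flip,
   that is, integrals of [F'] over intervals of length [2 ^- a.+1].  By Fubini
   this replaces [F] by [F'] and the weight in front of the Rademacher function
   by a new weight.  Using up the exponents of [k] from the largest one down, and
   starting from the constant weight 1, every weight is nonnegative, its mean is
   the product of the [2 ^- (a + 2)] over the exponents [a] used so far, and it is
   at most twice its mean.  After doing this in every coordinate, Hoelder's
   inequality gives the bound: the weight contributes its supremum to the power
   [1/p] and its mean to the remaining power. *)
From HB Require Import structures.
Require Import Defs.
From mathcomp Require Import all_boot all_order all_algebra.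
From mathcomp Require Import all_classical all_reals all_analysis.
From mathcomp Require Import measurable_realfun ess_sup_inf ring lra zify.
Set Implicit Arguments.
Unset Strict Implicit.
Unset Printing Implicit Defensive.
Import Order.TTheory GRing.Theory Num.Theory.
Import numFieldNormedType.Exports.
Local Open Scope classical_set_scope.
Local Open Scope ring_scope.

(** * Bounded measurable functions on probability spaces *)

(** Taking the largest exponent first secures two invariances at digit [a]: the weight built so far,
    made of windows of larger index, is unchanged when digit [a] is flipped, and the Rademacher
    factors still waiting, of smaller index, are constant on the window between [x] and its flip.
    Each exponent costs [2 ^- (a + 2)]: a half from averaging with the flip, times the window
    length. The ratio 2 between supremum and mean compares a dyadic cell of level [a] with a window,
    which is half as long. A separate obstacle is that derivatives exist only on the closed cube,
    one-sided on its faces, while Fubini and changes of variables are smoothest for total functions.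
    So functions are precomposed with the retraction onto the cube, and Lebesgue measure on the cube
    is treated as a probability on the whole space, against which bounded measurable functions are
    always integrable. *)

Section bounded_measurable.
Context {d} {T : measurableType d} {R : realType}.
Implicit Types f g : T -> R.

(** The bound holds everywhere, not almost everywhere, so that every section of a function on a
    product and every composite with a measurable map inherits it. *)
Definition bmeas f := measurable_fun setT f /\ exists M, forall x, `|f x| <= M.

Lemma bmeas_cst (c : R) : bmeas (fun=> c).
Proof. by split; [exact: measurable_cst|exists `|c|]. Qed.

Lemma bmeasM f g : bmeas f -> bmeas g -> bmeas (fun x => f x * g x).
Proof.
move=> [mf [M fM]] [mg [N gN]]; split; first exact: measurable_funM.
by exists (M * N) => x; rewrite normrM ler_pM.
Qed.

Lemma bmeasD f g : bmeas f -> bmeas g -> bmeas (fun x => f x + g x).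
Proof.
move=> [mf [M fM]] [mg [N gN]]; split; first exact: measurable_funD.
by exists (M + N) => x; rewrite (le_trans (ler_normD _ _))// lerD.
Qed.

Lemma bmeasN f : bmeas f -> bmeas (fun x => - f x).
Proof.
move=> [mf [M fM]]; split; first exact: measurableT_comp.
by exists M => x; rewrite normrN.
Qed.

Lemma bmeasB f g : bmeas f -> bmeas g -> bmeas (fun x => f x - g x).
Proof. by move=> bf /bmeasN; exact: bmeasD. Qed.

Lemma bmeas_norm f : bmeas f -> bmeas (fun x => `|f x|).
Proof.
move=> [mf [M fM]]; split; first exact: measurableT_comp.
by exists M => x; rewrite normr_id.
Qed.

Lemma bmeas_prod (I : Type) (r : seq I) (F : I -> T -> R) :
  (forall i, bmeas (F i)) -> bmeas (fun x => \prod_(i <- r) F i x).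
Proof.
move=> bF; elim: r => [|i r IH].
  rewrite (_ : (fun _ => _) = fun=> 1); first exact: bmeas_cst.
  by apply/funext => x; rewrite big_nil.
rewrite (_ : (fun _ => _) = fun x => F i x * \prod_(j <- r) F j x).
  exact: bmeasM.
by apply/funext => x; rewrite big_cons.
Qed.

Lemma bmeas_indicator (b : T -> bool) :
  measurable [set x | b x] -> bmeas (fun x => (b x)%:R).
Proof.
move=> mb; split; last by exists 1 => x; case: (b x); rewrite ?normr1 ?normr0.
rewrite (_ : (fun _ => _) = \1_[set x | b x]); first exact: measurable_indic.
by apply/funext => x; rewrite indicE mem_setE.
Qed.

(** The conclusion is [bmeas] written out: inside the section [bmeas] is tied to [T], while the
    composite lives on [T']. *)
Lemma bmeas_comp d' (T' : measurableType d') (phi : T' -> T) f :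
  measurable_fun setT phi -> bmeas f ->
  measurable_fun setT (fun x => f (phi x)) /\
  exists M, forall x, `|f (phi x)| <= M.
Proof.
move=> mphi [mf [M fM]]; split; first exact: measurableT_comp.
by exists M.
Qed.

End bounded_measurable.

Section probability_integral.
Context {d} {T : measurableType d} {R : realType} (P : probability T R).
Implicit Types f g : T -> R.

Lemma bmeas_integrable f : bmeas f -> P.-integrable setT (EFin \o f).
Proof.
move=> [mf [M fM]]; apply: measurable_bounded_integrable => //.
  by apply: le_lt_trans (probability_le1 P measurableT) _; exact: ltry.
exists M; split; first exact: num_real.
by move=> N MN x _; apply: le_trans (fM x) _; exact: ltW.
Qed.

Lemma EFin_Rintegral f : bmeas f ->
  (\int[P]_x f x)%:E = (\int[P]_x (f x)%:E)%E.
Proof.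
by move=> /bmeas_integrable bf; rewrite /Rintegral fineK// integrable_fin_num.
Qed.

Lemma bmeas_RintegralB f g : bmeas f -> bmeas g ->
  \int[P]_x (f x - g x) = \int[P]_x f x - \int[P]_x g x.
Proof. by move=> /bmeas_integrable ? /bmeas_integrable ?; rewrite RintegralB. Qed.

Lemma bmeas_RintegralZl c f : bmeas f ->
  \int[P]_x (c * f x) = c * \int[P]_x f x.
Proof. by move=> /bmeas_integrable ?; rewrite RintegralZl. Qed.

Lemma bmeas_RintegralZr c f : bmeas f ->
  \int[P]_x (f x * c) = \int[P]_x f x * c.
Proof. by move=> /bmeas_integrable ?; rewrite RintegralZr. Qed.

Lemma bmeas_RintegralN f : bmeas f ->
  \int[P]_x (- f x) = - \int[P]_x f x.
Proof.
move=> bf; rewrite -mulN1r -bmeas_RintegralZl//; apply: eq_Rintegral => x _.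
by rewrite mulN1r.
Qed.

Lemma bmeas_le_Rintegral f g : bmeas f -> bmeas g -> (forall x, f x <= g x) ->
  \int[P]_x f x <= \int[P]_x g x.
Proof.
by move=> /bmeas_integrable ? /bmeas_integrable ? fg; apply: le_Rintegral => //= x _.
Qed.

Lemma bmeas_le_normr_Rintegral f : bmeas f ->
  `|\int[P]_x f x| <= \int[P]_x `|f x|.
Proof. by move=> /bmeas_integrable ?; apply: le_normr_Rintegral. Qed.

Lemma Rintegral_prob_cst c : \int[P]_x c = c.
Proof.
by rewrite Rintegral_cst// [X in fine X](_ : _ = 1%E) ?mulr1//; exact: probability_setT.
Qed.

Lemma bmeas_normr_Rintegral_le f M : bmeas f -> (forall x, `|f x| <= M) ->
  `|\int[P]_x f x| <= M.
Proof.
move=> bf fM; apply: (le_trans (bmeas_le_normr_Rintegral bf)).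
rewrite -[leRHS]Rintegral_prob_cst.
by apply: bmeas_le_Rintegral => //; [exact: bmeas_norm|exact: bmeas_cst].
Qed.

Lemma bmeas_eq_Rintegral (D : set T) f g : measurable D -> P (~` D) = 0%E ->
  bmeas f -> bmeas g -> {in D, f =1 g} -> \int[P]_x f x = \int[P]_x g x.
Proof.
move=> mD PD [mf _] [mg _] fg; rewrite /Rintegral; congr fine.
apply: ae_eq_integral => //; [exact/measurable_EFinP|exact/measurable_EFinP|].
exists (~` D); split => //; first exact: measurableC.
move=> x /= nfg Dx; apply: nfg => _; rewrite fg//; exact: mem_set.
Qed.

End probability_integral.

Section probability_Fubini.
Context {d1 d2} {T1 : measurableType d1} {T2 : measurableType d2} {R : realType}.
Context (P1 : probability T1 R) (P2 : probability T2 R) (F : T1 * T2 -> R).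
Hypothesis bF : bmeas F.

Let PF : (P1 \x P2)%E.-integrable setT (EFin \o F).
Proof. exact: (bmeas_integrable (P1 \x P2)%E bF). Qed.

Lemma bmeas_fst y : bmeas (fun x => F (x, y)).
Proof. by apply: bmeas_comp bF; exact: measurable_pair2. Qed.

Lemma bmeas_snd x : bmeas (fun y => F (x, y)).
Proof. by apply: bmeas_comp bF; exact: measurable_pair1. Qed.

Lemma bmeas_Rintegral_snd : bmeas (fun x => \int[P2]_y F (x, y)).
Proof.
split; last first.
  have [_ [M FM]] := bF; exists M => x.
  by apply: bmeas_normr_Rintegral_le => //; exact: bmeas_snd.
apply/measurable_EFinP.
rewrite (_ : EFin \o _ = fubini_F P2 (EFin \o F)).
  exact: measurable_fubini_F PF.
by apply/funext => x; rewrite /= EFin_Rintegral//; exact: bmeas_snd.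
Qed.

Lemma bmeas_Rintegral_fst : bmeas (fun y => \int[P1]_x F (x, y)).
Proof.
split; last first.
  have [_ [M FM]] := bF; exists M => x.
  by apply: bmeas_normr_Rintegral_le => //; exact: bmeas_fst.
apply/measurable_EFinP.
rewrite (_ : EFin \o _ = fubini_G P1 (EFin \o F)).
  exact: measurable_fubini_G PF.
by apply/funext => x; rewrite /= EFin_Rintegral//; exact: bmeas_fst.
Qed.

Lemma Rintegral_prod :
  \int[(P1 \x P2)%E]_z F z = \int[P1]_x \int[P2]_y F (x, y).
Proof.
apply: EFin_inj; rewrite EFin_Rintegral; last exact: bmeas_Rintegral_snd.
rewrite (EFin_Rintegral (P1 \x P2)%E)// -(integral12_prod_meas1 PF).
by apply: eq_integral => x _; rewrite EFin_Rintegral//; exact: bmeas_snd.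
Qed.

Lemma Rintegral_swap :
  \int[P1]_x \int[P2]_y F (x, y) = \int[P2]_y \int[P1]_x F (x, y).
Proof.
apply: EFin_inj; rewrite !EFin_Rintegral.
- under eq_integral => x _ do rewrite (EFin_Rintegral P2 (bmeas_snd x)).
  rewrite (Fubini PF); apply: eq_integral => x _.
  by rewrite EFin_Rintegral//; exact: bmeas_fst.
- exact: bmeas_Rintegral_fst.
- exact: bmeas_Rintegral_snd.
Qed.

End probability_Fubini.

Section pushforward_integral.
Context {d1 d2} {T1 : measurableType d1} {T2 : measurableType d2} {R : realType}.
Context (P1 : probability T1 R) (P2 : probability T2 R) (phi : T1 -> T2).
Hypothesis mphi : measurable_fun setT phi.
Hypothesis P12 : forall A, measurable A -> P1 (phi @^-1` A) = P2 A.

Lemma Rintegral_measure_preserving (G : T2 -> R) : bmeas G ->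
  \int[P2]_y G y = \int[P1]_x G (phi x).
Proof.
move=> bG; rewrite /Rintegral; congr fine.
rewrite -(@eq_measure_integral _ _ _ _ _ (pushforward P1 phi)).
  rewrite integral_pushforward//; first by case: bG => mG _; exact/measurable_EFinP.
  by rewrite preimage_setT; apply: bmeas_integrable; exact: bmeas_comp bG.
by move=> A mA _; exact: P12.
Qed.

End pushforward_integral.

(** * The uniform probabilities on [0,1) and on the unit cube *)

Section boxes.
Context {R : realType}.
Local Notation RT := (measurableTypeR R).

Definition box n (A : 'I_n -> set RT) : set (n.-tuple RT) :=
  [set x | forall i, A i (tnth x i)].

Lemma measurable_box n (A : 'I_n -> set RT) :
  (forall i, measurable (A i)) -> measurable (box A).
Proof.
move=> mA.
rewrite (_ : box A = \bigcap_(i in [set: 'I_n]) ((@tnth n RT)^~ i @^-1` A i)).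
  apply: fin_bigcap_measurable => // i _.
  by rewrite -[X in measurable X]setTI; exact: measurable_tnth.
by apply/seteqP; split => x /= h i; have := h i => //; exact.
Qed.

Lemma boxI n (A B : 'I_n -> set RT) : box A `&` box B = box (fun i => A i `&` B i).
Proof.
apply/seteqP; split => x /=; first by move=> [a b] i; split; [exact: a|exact: b].
by move=> h; split=> i; have [] := h i.
Qed.

Lemma boxT n : box (fun _ : 'I_n => setT) = setT.
Proof. by apply/seteqP; split => x. Qed.

(** Boxes are stable under intersection and generate the product sigma-algebra, so a finite measure
    is determined by its values on them. *)
Lemma measure_preserving_box d (T : measurableType d) n
    (P : probability T R) (Q : probability (n.-tuple RT) R)
    (phi : T -> n.-tuple RT) : measurable_fun setT phi ->
  (forall A, (forall i, measurable (A i)) ->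
    P (phi @^-1` box A) = Q (box A)) ->
  forall X, measurable X -> P (phi @^-1` X) = Q X.
Proof.
move=> mphi PQ X mX; apply/esym; move: X mX.
suff : forall X, measurable X -> Q X = pushforward P phi X by [].
apply: (measure_unique
  [set X | exists2 A : 'I_n -> set RT, (forall i, measurable (A i)) & X = box A]
  (fun=> setT)).
- apply/seteqP; split.
    apply: smallest_sub; first exact: smallest_sigma_algebra.
    rewrite -bigcup_seq => X [i /= _ [B mB <-]]; apply: sub_gen_smallest.
    (* A generator constrains the single coordinate [i]: it is a box with all other sides full. *)
    exists (fun j => if j == i then B else setT).
      by move=> j; case: ifP.
    rewrite setTI; apply/seteqP; split => x /=.
      by move=> Bx j; case: eqP => // ->.
    by move=> /(_ i); rewrite eqxx.
  apply: smallest_sub; first exact: sigma_algebra_measurable.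
  by move=> _ [A mA ->]; exact: measurable_box.
- move=> _ _ [A mA ->] [B mB ->]; exists (fun i => A i `&` B i) => //.
    by move=> i; exact: measurableI.
  by rewrite boxI.
- by move=> _; exists (fun=> setT) => //; rewrite boxT.
- by apply/seteqP; split => // x _; exists 0%N.
- by move=> _ [A mA ->]; exact/esym/PQ.
- by move=> _; apply: le_lt_trans (probability_le1 Q measurableT) _; exact: ltry.
Qed.

Definition itv01 : set RT := [set` `[(0 : R), 1[ ].

Lemma measurable_itv01 : measurable itv01.
Proof. exact: measurable_itv. Qed.

Definition unif : set RT -> \bar R :=
  mrestr (@lebesgue_measure R) measurable_itv01.

HB.instance Definition _ := Measure.on unif.

Let unif_setT : unif setT = 1%E.
Proof.
by rewrite /unif /mrestr setTI lebesgue_measure_itv/= lte_fin ltr01 sube0.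
Qed.

HB.instance Definition _ := Measure_isProbability.Build _ _ R unif unif_setT.

Lemma unit_cubeE n : @unit_cube R n = box (fun _ : 'I_n => itv01).
Proof.
by apply/seteqP; split => x /= h i; have := h i; rewrite /itv01 /= in_itv.
Qed.

Lemma measurable_unit_cube n : measurable (@unit_cube R n).
Proof.
by rewrite unit_cubeE; apply: measurable_box => i; exact: measurable_itv01.
Qed.

Definition cube_prob n : set (n.-tuple RT) -> \bar R :=
  mrestr (@lebesgue_tuple R n) (@measurable_unit_cube n).

HB.instance Definition _ n := Measure.on (@cube_prob n).

Lemma cube_prob_box n (A : 'I_n -> set RT) : (forall i, measurable (A i)) ->
  cube_prob (box A) = (\prod_(i < n) fine (unif (A i)))%:E.
Proof.
rewrite /cube_prob /mrestr unit_cubeE boxI.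
elim: n A => [|n IH] A mA.
  by rewrite big_ord0 /= diracE mem_set// => -[].
rewrite /= /lebesgue_cons /pushforward big_ord_recl EFinM.
rewrite (_ : _ @^-1` _ = (A ord0 `&` itv01) `*`
    box (fun i => A (lift ord0 i) `&` itv01)); last first.
  apply/seteqP; split=> -[x y] /=.
    move=> h; split; first by have := h ord0; rewrite tnth0.
    by move=> i; have := h (lift ord0 i); rewrite tnthS.
  move=> [h1 h2] i; have [j ->|->] := unliftP ord0 i.
    by rewrite tnthS; exact: h2.
  by rewrite tnth0.
rewrite product_measure1E//=; last 2 first.
- by apply: measurableI => //; exact: measurable_itv01.
- by apply: measurable_box => i; apply: measurableI => //; exact: measurable_itv01.
rewrite IH//; congr *%E.
by rewrite fineK// -/(unif _) fin_num_measure.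
Qed.

Let cube_prob_setT n : cube_prob (n := n) setT = 1%E.
Proof.
rewrite -boxT cube_prob_box// big1// => i _.
by rewrite (_ : unif setT = 1%E).
Qed.

HB.instance Definition _ n :=
  Measure_isProbability.Build _ _ R (@cube_prob n) (@cube_prob_setT n).

Lemma unif_itvC : unif (~` itv01) = 0%E.
Proof. by rewrite /unif /mrestr setICl measure0. Qed.

Lemma cube_probC n : cube_prob (~` @unit_cube R n) = 0%E.
Proof. by rewrite /cube_prob /mrestr setICl measure0. Qed.

(** Bridge from the integrals of the statement to [cube_prob]: a globally bounded measurable [g]
    stands in for [f], whose values matter on the cube only. *)
Lemma Rintegral_unit_cube n (f g : n.-tuple RT -> R) :
    bmeas g -> {in @unit_cube R n, f =1 g} ->
  \int[lebesgue_tuple n]_(x in @unit_cube R n) f x = \int[@cube_prob n]_x g x.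
Proof.
move=> bg fg; rewrite (eq_Rintegral _ fg).
have mD := @measurable_unit_cube n.
rewrite /Rintegral; congr fine.
rewrite (@eq_measure_integral _ _ _ _ (@cube_prob n)); last first.
  by move=> A mA Ac; rewrite /= /cube_prob /mrestr setIidl.
rewrite integral_mkcond; apply: ae_eq_integral => //.
- apply/(measurable_restrictT _ _).1 => //.
  by apply: measurable_funTS; apply/measurable_EFinP; case: bg.
- by apply/measurable_EFinP; case: bg.
exists (~` @unit_cube R n); split => //; first exact: measurableC.
  exact: cube_probC.
move=> x /= h Dx; apply: h => _; rewrite patchE mem_set//.
Qed.

End boxes.

(** * Fubini's theorem along coordinates *)

Section coordinates.
Context {R : realType}.
Local Notation RT := (measurableTypeR R).

Definition upd n (x : n.-tuple RT) (i : 'I_n) (t : RT) : n.-tuple RT :=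
  [tuple if j == i then t else tnth x j | j < n].

Lemma measurable_upd n (i : 'I_n) :
  measurable_fun setT (fun z : n.-tuple RT * RT => upd z.1 i z.2).
Proof.
apply/measurable_fun_tnthP => j.
rewrite (_ : _ \o _ = fun z => if j == i then z.2 else tnth z.1 j); last first.
  by apply/funext => z; rewrite /= tnth_mktuple.
case: (j == i); first exact: measurable_snd.
by apply: (@measurableT_comp _ _ _ _ _ _ (fun x => tnth x j)) => //;
    exact: measurable_tnth.
Qed.

Lemma bmeas_upd n (i : 'I_n) (G : n.-tuple RT -> R) : bmeas G ->
  bmeas (fun z : n.-tuple RT * RT => G (upd z.1 i z.2)).
Proof. by move=> bG; apply: bmeas_comp bG; exact: measurable_upd. Qed.

(** Replacing coordinate [i] by an independent uniform variable preserves the law of the point: on a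
    box, the discarded coordinate contributes 1 and the fresh one restores the factor of side [i].
    This is Fubini along [i] without splitting the tuple. *)
Lemma Rintegral_cube_upd n (i : 'I_n) (G : n.-tuple RT -> R) : bmeas G ->
  \int[@cube_prob R n]_x G x =
  \int[@cube_prob R n]_x \int[@unif R]_t G (upd x i t).
Proof.
move=> bG.
transitivity (\int[(@cube_prob R n \x @unif R)%E]_z G (upd z.1 i z.2)); last first.
  exact: (Rintegral_prod (@cube_prob R n) (@unif R) (bmeas_upd i bG)).
apply: Rintegral_measure_preserving bG; first exact: measurable_upd.
apply: measure_preserving_box; first exact: measurable_upd.
move=> A mA; pose B j := if j == i then setT else A j.
have mB j : measurable (B j) by rewrite /B; case: ifP.
rewrite (_ : _ @^-1` _ = box B `*` A i); last first.
  apply/seteqP; split => -[x t] /=.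
    move=> h; split; last by have := h i; rewrite tnth_mktuple eqxx.
    by move=> j; have := h j; rewrite /B tnth_mktuple; case: ifP.
  move=> [h1 h2] j; rewrite tnth_mktuple; case: eqP => [->//|/eqP ji].
  by have := h1 j; rewrite /B (negbTE ji).
rewrite /= product_measure1E//=; last exact: measurable_box.
rewrite !cube_prob_box// -(fineK (fin_num_measure (@unif R) _ (mA i))) -EFinM.
congr EFin; rewrite (bigD1 i)//= [in RHS](bigD1 i)//= /B eqxx.
rewrite (_ : unif setT = 1%E); last exact: (probability_setT (@unif R)).
rewrite mul1r mulrC; congr (_ * _); apply: eq_bigr => j ji.
by rewrite (negbTE ji).
Qed.

Section glue.
Context {s : nat} (v : {set 'I_s}).

Let glueR (y : #|v|.-tuple RT) (z : #|~: v|.-tuple RT) : s.-tuple RT :=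
  @Defs.glue s v R y z.

Lemma nth_index_enum (A : {set 'I_s}) (y : #|A|.-tuple RT) (k : 'I_#|A|) :
  nth 0 y (index (enum_val k) (enum A)) = tnth y k.
Proof.
rewrite (tnth_nth 0) /enum_val index_uniq//; last exact: enum_uniq.
by rewrite -cardE.
Qed.

Lemma tnth_glue_in y z (k : 'I_#|v|) :
  tnth (glueR y z) (enum_val k) = tnth y k.
Proof. by rewrite tnth_mktuple enum_valP -nth_index_enum. Qed.

Lemma tnth_glue_notin y z (k : 'I_#|~: v|) :
  tnth (glueR y z) (enum_val k) = tnth z k.
Proof.
have := enum_valP k; rewrite inE => /negbTE kv.
by rewrite tnth_mktuple kv -nth_index_enum.
Qed.

Lemma ord_glue_ind (Q : 'I_s -> Prop) :
  (forall k : 'I_#|v|, Q (enum_val k)) ->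
  (forall k : 'I_#|~: v|, Q (enum_val k)) -> forall i, Q i.
Proof.
move=> Qv Qc i; have [iv|niv] := boolP (i \in v).
  by rewrite -(enum_rankK_in iv iv).
have ic : i \in ~: v by rewrite inE.
by rewrite -(enum_rankK_in ic ic).
Qed.

Lemma measurable_glue :
  measurable_fun setT (fun z : #|v|.-tuple RT * #|~: v|.-tuple RT => glueR z.1 z.2).
Proof.
apply/measurable_fun_tnthP; apply: ord_glue_ind => k.
  rewrite (_ : _ \o _ = fun z => tnth z.1 k).
    by apply: (@measurableT_comp _ _ _ _ _ _ (fun x => tnth x k)) => //;
    exact: measurable_tnth.
  by apply/funext => z /=; rewrite tnth_glue_in.
rewrite (_ : _ \o _ = fun z => tnth z.2 k).
  by apply: (@measurableT_comp _ _ _ _ _ _ (fun x => tnth x k)) => //;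
    exact: measurable_tnth.
by apply/funext => z /=; rewrite tnth_glue_notin.
Qed.

Lemma prod_glue (F : 'I_s -> R) :
  \prod_i F i = (\prod_(k < #|v|) F (enum_val k)) *
                (\prod_(k < #|~: v|) F (enum_val k)).
Proof.
rewrite (bigID [in v])/=; congr (_ * _); first by rewrite big_enum_val.
by rewrite -(big_enum_val F); apply: eq_bigl => i; rewrite inE.
Qed.

Lemma bmeas_glue (G : s.-tuple RT -> R) : bmeas G ->
  bmeas (fun z : #|v|.-tuple RT * #|~: v|.-tuple RT => G (glueR z.1 z.2)).
Proof. by move=> bG; apply: bmeas_comp bG; exact: measurable_glue. Qed.

Lemma Rintegral_cube_glue (G : s.-tuple RT -> R) : bmeas G ->
  \int[@cube_prob R s]_x G x =
  \int[@cube_prob R #|v|]_y \int[@cube_prob R #|~: v|]_z G (Defs.glue y z).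
Proof.
move=> bG.
transitivity (\int[(@cube_prob R #|v| \x @cube_prob R #|~: v|)%E]_z
    G (glueR z.1 z.2)); last first.
  exact: (Rintegral_prod (@cube_prob R _) (@cube_prob R _) (bmeas_glue bG)).
apply: Rintegral_measure_preserving bG; first exact: measurable_glue.
apply: measure_preserving_box; first exact: measurable_glue.
move=> A mA.
rewrite (_ : _ @^-1` _ = box (fun k : 'I_#|v| => A (enum_val k)) `*`
    box (fun k : 'I_#|~: v| => A (enum_val k))); last first.
  apply/seteqP; split => -[y z] /=.
    move=> h; split=> k.
      by have := h (enum_val k); rewrite tnth_glue_in.
    by have := h (enum_val k); rewrite tnth_glue_notin.
  move=> [hy hz]; apply: ord_glue_ind => k.
    by rewrite tnth_glue_in; exact: hy.
  by rewrite tnth_glue_notin; exact: hz.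
rewrite /= product_measure1E//=; [|exact: measurable_box..].
by rewrite !cube_prob_box// -EFinM prod_glue.
Qed.

End glue.

End coordinates.

(** * Binary digits and dyadic cells *)

Section dyadic_cells.
Context {R : realType}.
Local Notation RT := (measurableTypeR R).
Implicit Types (x y u : R) (a b m : nat).

(** For [x] in [0,1), the integer formed by the first [a] binary digits, which indexes the dyadic
    interval of length [2 ^- a] containing [x]. Digits become parities, and dyadic shifts become
    additions in [nat]. *)
Definition cell a x : nat := Num.trunc (2 ^+ a * x).

Definition dig a x : bool := odd (cell a.+1 x).

Definition rademacher a x : R := (-1) ^+ dig a x.

Definition flip_digit a x : R := x + rademacher a x * 2 ^- a.+1.

(* Clears the digit [a] of [x]. *)
Definition low a x : R := x - (dig a x)%:R * 2 ^- a.+1.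

(** For [x] in [0,1), the half-open interval between [x] and its flip. *)
Definition win a x u : bool := low a x <= u < low a x + 2 ^- a.+1.

Lemma pow2_gt0 a : 0 < 2 ^+ a :> R. Proof. by rewrite exprn_gt0. Qed.

Lemma pow2V_gt0 a : 0 < 2 ^- a :> R. Proof. by rewrite invr_gt0 pow2_gt0. Qed.

Lemma pow2_subn a b : (b <= a)%N -> 2 ^+ a * 2 ^- b = (2 ^ (a - b))%:R :> R.
Proof.
by move=> ba; rewrite natrX -{1}(subnK ba) exprD mulfK// gt_eqF// pow2_gt0.
Qed.

Lemma cellP a x : 0 <= x -> (cell a x)%:R <= 2 ^+ a * x < (cell a x).+1%:R.
Proof. by move=> x0; apply: truncn_itv; rewrite mulr_ge0// ltW// pow2_gt0. Qed.

Lemma cell_def a x m : m%:R <= 2 ^+ a * x < m.+1%:R -> cell a x = m.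
Proof. exact: truncn_def. Qed.

Lemma cell_lt a x : 0 <= x < 1 -> (cell a x < 2 ^ a)%N.
Proof.
move=> /andP[x0 x1]; have /andP[xl _] := cellP a x0.
rewrite -(ltr_nat R) (le_lt_trans xl)// natrX.
by rewrite -[ltRHS]mulr1 ltr_pM2l// pow2_gt0.
Qed.

Lemma cell_half a x : 0 <= x -> cell a x = (cell a.+1 x)./2.
Proof.
move=> x0; apply: cell_def; have := cellP a.+1 x0; rewrite exprS -mulrA.
set m := cell _ _; set y := 2 ^+ a * x => /andP[].
have : m%:R = (odd m)%:R + 2 * (m./2)%:R :> R.
  by rewrite -[in LHS](odd_double_half m) natrD -mul2n natrM.
by rewrite -!natr1; case: (odd m) => /= -> ? ?; apply/andP; split; lra.
Qed.

Lemma eq_cell_le a b x u : 0 <= x -> 0 <= u -> (b <= a)%N ->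
  cell a x = cell a u -> cell b x = cell b u.
Proof.
move=> x0 u0; elim: a => [|a IH]; first by rewrite leqn0 => /eqP ->.
rewrite leq_eqVlt => /predU1P[->//|]; rewrite ltnS => ba E.
by apply: IH => //; rewrite cell_half// E -cell_half.
Qed.

Lemma cell_shift a b y : 0 <= y -> (b <= a)%N ->
  cell a (y + 2 ^- b) = (cell a y + 2 ^ (a - b))%N.
Proof.
move=> y0 ba; apply: cell_def; rewrite mulrDr pow2_subn// -addSn !natrD.
by have /andP[? ?] := cellP a y0; rewrite lerD2r ltrD2r; apply/andP.
Qed.

(** The points of [0,1) pair up as [y] and [y + 2 ^- a.+1] with digit [a] of [y] equal to 0, and [x]
    is the lower or the upper one. Facts about flips are read off the lower point, where
    [cell_shift] applies. *)
Lemma flip_cases a x : 0 <= x < 1 ->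
  (dig a x = false /\ flip_digit a x = x + 2 ^- a.+1 /\ low a x = x) \/
  (exists y, [/\ 0 <= y < 1, dig a y = false, x = y + 2 ^- a.+1,
    flip_digit a x = y & low a x = y /\ dig a x = true]).
Proof.
move=> /andP[x0 x1]; rewrite /flip_digit /low /rademacher.
case E : (dig a x) => /=; last first.
  by left; rewrite mul0r subr0 expr0 mul1r.
right; exists (x - 2 ^- a.+1); rewrite expr1 mulN1r mul1r.
have hx : 2 ^- a.+1 <= x.
  have /andP[h1 _] := cellP a.+1 x0.
  rewrite -(ler_pM2l (pow2_gt0 a.+1)) mulfV ?gt_eqF ?pow2_gt0// (le_trans _ h1)//.
  by rewrite ler1n; move: E; rewrite /dig; case: cell.
have y0 : 0 <= x - 2 ^- a.+1 by rewrite subr_ge0.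
split => //.
- rewrite y0/= (le_lt_trans _ x1)// lerBlDr lerDl.
  exact: ltW (pow2V_gt0 _).
- have := E; rewrite /dig -{1}(subrK (2 ^- a.+1) x) cell_shift// subnn expn0.
  by rewrite addn1 /=; case: odd.
- by rewrite subrK.
Qed.

Lemma dig_shift a y : 0 <= y -> dig a (y + 2 ^- a.+1) = ~~ dig a y.
Proof. by move=> y0; rewrite /dig cell_shift// subnn addn1. Qed.

Lemma dig_shift_lt a b y : 0 <= y -> (b < a)%N ->
  dig a (y + 2 ^- b.+1) = dig a y.
Proof.
move=> y0 ba; rewrite /dig cell_shift//; last exact: ltnW.
by rewrite subSS oddD oddX/= orbF subn_eq0 leqNgt ba addbF.
Qed.

Lemma cell_low_shift a y : 0 <= y -> dig a y = false ->
  cell a (y + 2 ^- a.+1) = cell a y.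
Proof.
move=> y0 dy; rewrite cell_half ?addr_ge0// ?(ltW (pow2V_gt0 _))//.
rewrite cell_shift// subnn [RHS]cell_half//.
by move: dy; rewrite /dig halfD => ->; rewrite addn0.
Qed.

(** By parity: [cell a.+1 y] is even and below the even number [2 ^ a.+1], so its successor is still
    below, which leaves room for a shift by one cell. *)
Lemma low_lt1 a y : 0 <= y < 1 -> dig a y = false -> y + 2 ^- a.+1 < 1.
Proof.
move=> y01 dy; have /andP[y0 y1] := y01.
have e : 2 ^+ a.+1 * 2 ^- a.+1 = 1 :> R by rewrite mulfV// gt_eqF// pow2_gt0.
rewrite -(ltr_pM2l (pow2_gt0 a.+1)) mulrDr e mulr1.
have /andP[_ h] := cellP a.+1 y0.
rewrite (@lt_le_trans _ _ ((cell a.+1 y).+2%:R))//.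
  by rewrite -[ltRHS]natr1 ltrD2r.
rewrite -natrX ler_nat; have := cell_lt a.+1 y01.
rewrite leq_eqVlt => /predU1P[|//] E.
by move: dy; rewrite /dig; have := congr1 odd E; rewrite oddX /= => /negbFE ->.
Qed.

Lemma flip_digit_itv a x : 0 <= x < 1 -> 0 <= flip_digit a x < 1.
Proof.
move=> x01; have [[d [-> _]]|[y [y01 _ _ -> _]]] := flip_cases a x01 => //.
by rewrite low_lt1// andbT addr_ge0//; case/andP: x01.
Qed.

Lemma dig_flip a x : 0 <= x < 1 -> dig a (flip_digit a x) = ~~ dig a x.
Proof.
move=> x01; have [[d [-> _]]|[y [y01 dy xE -> _]]] := flip_cases a x01.
  by rewrite dig_shift//; case/andP: x01.
by rewrite xE dig_shift ?dy//; case/andP: y01.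
Qed.

Lemma rademacher_flip a x : 0 <= x < 1 ->
  rademacher a (flip_digit a x) = - rademacher a x.
Proof. by move=> x01; rewrite /rademacher dig_flip// signrN. Qed.

Lemma flip_digitK a x : 0 <= x < 1 -> flip_digit a (flip_digit a x) = x.
Proof.
move=> x01; rewrite {1}/flip_digit rademacher_flip// /flip_digit mulNr addrK//.
Qed.

Lemma cell_flip a b x : 0 <= x < 1 -> (b <= a)%N ->
  cell b (flip_digit a x) = cell b x.
Proof.
move=> x01 ba; have fx := flip_digit_itv a x01.
apply: (@eq_cell_le a) => //; [by case/andP: fx|by case/andP: x01|].
have [[d [-> _]]|[y [y01 dy xE -> _]]] := flip_cases a x01.
  by rewrite cell_low_shift//; case/andP: x01.
by rewrite xE cell_low_shift//; case/andP: y01.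
Qed.

Lemma dig_flip_lt a b x : 0 <= x < 1 -> (b < a)%N ->
  dig a (flip_digit b x) = dig a x.
Proof.
move=> x01 ba; have [[d [-> _]]|[y [y01 dy xE -> _]]] := flip_cases b x01.
  by rewrite dig_shift_lt//; case/andP: x01.
by rewrite xE dig_shift_lt//; case/andP: y01.
Qed.

Lemma dig_flip_ltC a b x : 0 <= x < 1 -> (a < b)%N ->
  dig a (flip_digit b x) = dig a x.
Proof. by move=> x01 ab; rewrite /dig cell_flip. Qed.

Lemma low_itv a x : 0 <= x < 1 ->
  [/\ 0 <= low a x, low a x + 2 ^- a.+1 < 1 & dig a (low a x) = false].
Proof.
move=> x01; have [[d [_ ->]]|[y [y01 dy _ _ [-> _]]]] := flip_cases a x01.
  by split => //; [case/andP: x01|exact: low_lt1].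
by split => //; [case/andP: y01|exact: low_lt1].
Qed.

Lemma low_cell a x : 0 <= x < 1 -> cell a (low a x) = cell a x.
Proof.
move=> x01; have [[d [_ ->//]]|[y [y01 dy -> _ [_ _]]]] := flip_cases a x01.
have y0 : 0 <= y by case/andP: y01.
by rewrite /low dig_shift// dy/= mul1r addrK cell_low_shift.
Qed.

(** The window starts in the left half of a cell of level [a], because [low a x] has digit 0 there,
    and it is half a cell long, so it cannot leave the cell. *)
Lemma win_cell a x u : 0 <= x < 1 -> win a x u ->
  (0 <= u < 1) && (cell a u == cell a x).
Proof.
move=> x01 /andP[lu ul]; have [l0 l1 dl] := low_itv a x01.
have u0 : 0 <= u := le_trans l0 lu.
rewrite u0 (lt_trans ul l1)/= -(low_cell a x01).
rewrite (cell_half a u0) (cell_half a l0).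
have c1 : (cell a.+1 (low a x) <= cell a.+1 u)%N.
  by apply: le_truncn; rewrite ler_pM2l// pow2_gt0.
have c2 : (cell a.+1 u <= cell a.+1 (low a x) + 1)%N.
  have := cell_shift l0 (leqnn a.+1); rewrite subnn expn0 => <-.
  by apply: le_truncn; rewrite ler_pM2l ?pow2_gt0// ltW.
move: dl c1 c2; rewrite /dig; set m := cell _ _; set k := cell _ u => dl c1 c2.
by apply/eqP; move: dl c1 c2; lia.
Qed.

(** Points of a common window share digit [b], since they share the cell of level [a]; the flip at
    [b] thus translates [x], [u] and the window alike. The converse follows because the flip is an
    involution. *)
Lemma win_flip a b x u : 0 <= x < 1 -> 0 <= u < 1 -> (b < a)%N ->
  win a (flip_digit b x) (flip_digit b u) = win a x u.
Proof.
move=> + + ba; suff H x' u' : 0 <= x' < 1 -> 0 <= u' < 1 ->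
    win a x' u' -> win a (flip_digit b x') (flip_digit b u').
  move=> x01 u01; apply/idP/idP; last exact: H.
  by move=> /H; rewrite !flip_digit_itv// !flip_digitK//; exact.
move=> x01 u01 w; have /andP[_ /eqP c] := win_cell x01 w.
have dE : dig b u' = dig b x'.
  rewrite /dig; congr odd; apply: (@eq_cell_le a) => //.
    by case/andP: u01.
  by case/andP: x01.
move: w; rewrite /win /low dig_flip_lt// /flip_digit /rademacher dE.
set d := (-1) ^+ _ * _; set k := _%:R * _; set h := 2 ^- _.
by move=> /andP[? ?]; apply/andP; split; lra.
Qed.

Lemma measurable_cell a : measurable_fun setT (fun x : RT => (cell a x)%:R : R).
Proof.
apply: nondecreasing_measurable => // x y xy.
by rewrite ler_nat; apply: le_truncn; rewrite ler_pM2l// pow2_gt0.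
Qed.

Lemma measurable_dig a : measurable_fun setT (fun x : RT => (dig a x)%:R : R).
Proof.
(* A parity is not monotone, but it is a difference of two nondecreasing functions. *)
rewrite (_ : (fun _ => _) =
    fun x => (cell a.+1 x)%:R - 2 * ((cell a.+1 x)./2)%:R).
  apply: measurable_funB; first exact: measurable_cell.
  apply: measurable_funM => //.
  apply: nondecreasing_measurable => // x y xy.
  by rewrite ler_nat half_leq//; apply: le_truncn; rewrite ler_pM2l// pow2_gt0.
apply/funext => x; rewrite /dig -natrM mul2n -{2}(odd_double_half (cell _ _)).
by rewrite natrD addrK.
Qed.

Lemma rademacherE a x : rademacher a x = 1 - 2 * (dig a x)%:R.
Proof. by rewrite /rademacher; case: dig => /=; rewrite ?expr1 ?expr0; lra. Qed.

Lemma bmeas_rademacher a : bmeas (rademacher a : RT -> R).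
Proof.
split; last by exists 1 => x; rewrite /rademacher normr_sign.
rewrite (_ : rademacher a = fun x => 1 - 2 * (dig a x)%:R); last first.
  by apply/funext => x; rewrite rademacherE.
apply: measurable_funB => //; apply: measurable_funM => //.
exact: measurable_dig.
Qed.

Lemma measurable_flip a : measurable_fun setT (flip_digit a : RT -> RT).
Proof.
apply: measurable_funD => //; apply: measurable_funM => //.
by case: (bmeas_rademacher a).
Qed.

Lemma measurable_low a : measurable_fun setT (low a : RT -> RT).
Proof.
apply: measurable_funB => //; apply: measurable_funM => //.
exact: measurable_dig.
Qed.

Lemma bmeas_win a : bmeas (fun z : RT * RT => (win a z.1 z.2)%:R : R).
Proof.
have ml : measurable_fun setT (fun z : RT * RT => low a z.1).
  by apply: measurableT_comp => //; exact: measurable_low.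
apply: bmeas_indicator; rewrite -[X in measurable X]setTI.
apply: (measurable_and (f := fun z : RT * RT => low a z.1 <= z.2)
  (g := fun z : RT * RT => z.2 < low a z.1 + 2 ^- a.+1)) => //.
- by apply: measurable_fun_ler.
- by apply: measurable_fun_ltr => //; exact: measurable_funD.
Qed.

Lemma bmeas_cell_eq a m : bmeas (fun x : RT => (cell a x == m)%:R : R).
Proof.
apply: bmeas_indicator.
rewrite (_ : [set _ | _] = (fun x : RT => (cell a x)%:R : R) @^-1` [set m%:R]).
  by rewrite -[X in measurable X]setTI; exact: measurable_cell.
by apply/seteqP; split => x /=; rewrite -(eqr_nat R) => /eqP.
Qed.

End dyadic_cells.

(** * Integrals over [0,1) and invariance under digit flips *)

Section unif_integral.
Context {R : realType}.
Local Notation RT := (measurableTypeR R).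
Local Notation U := (@unif R).
Implicit Types f g : RT -> R.

Lemma eq_Rintegral_unif f g : bmeas f -> bmeas g ->
  (forall x, 0 <= x < 1 -> f x = g x) -> \int[U]_x f x = \int[U]_x g x.
Proof.
move=> bf bg fg.
apply: (@bmeas_eq_Rintegral _ _ _ U itv01) => //.
- exact: measurable_itv01.
- exact: unif_itvC.
- by move=> x; rewrite inE /itv01 /= in_itv => /fg.
Qed.

Lemma bmeas_itv01 : bmeas (fun x : RT => (0 <= x < 1)%R%:R : R).
Proof.
apply: bmeas_indicator; rewrite (_ : [set _ | _] = itv01).
  exact: measurable_itv01.
by apply/seteqP; split => x; rewrite /itv01 /= in_itv.
Qed.

Lemma le_Rintegral_unif f g : bmeas f -> bmeas g ->
  (forall x, 0 <= x < 1 -> f x <= g x) -> \int[U]_x f x <= \int[U]_x g x.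
Proof.
move=> bf bg fg; have bi := bmeas_itv01.
rewrite (eq_Rintegral_unif bf (bmeasM bf bi)); last first.
  by move=> x ->; rewrite mulr1.
rewrite (eq_Rintegral_unif bg (bmeasM bg bi)); last first.
  by move=> x ->; rewrite mulr1.
apply: bmeas_le_Rintegral; [exact: bmeasM|exact: bmeasM|move=> x].
by have [/fg|_] := boolP (0 <= (x : R) < 1); rewrite ?mulr1 ?mulr0.
Qed.

Lemma unif_itv (a b : R) : 0 <= a <= b -> b <= 1 -> U `[a, b[%classic = (b - a)%:E.
Proof.
move=> /andP[a0 ab] b1; rewrite /unif /mrestr setIidl; last first.
  move=> x /=; rewrite /itv01 /= !in_itv/= => /andP[ax xb].
  by rewrite (le_trans a0 ax) (lt_le_trans xb b1).
rewrite lebesgue_measure_itv/= lte_fin; case: ltP => // ba.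
by rewrite (@le_anti _ _ a b) ?subrr// ab ba.
Qed.

Lemma lebesgue_measure_shift (c : R) (A : set RT) : measurable A ->
  lebesgue_measure ((fun x : RT => x + c : RT) @^-1` A) = lebesgue_measure A.
Proof.
move=> mA; have mc : measurable_fun setT (fun x : RT => x + c : RT).
  exact: measurable_funD.
suff -> : lebesgue_measure A =
    pushforward (@lebesgue_measure R) (fun x : RT => x + c : RT) A by [].
apply: lebesgue_measure_unique => // _ [[x y] _ <-] /=.
rewrite /pushforward (_ : _ @^-1` _ = `]x - c, y - c]%classic).
  rewrite !lebesgue_measure_itv/= !lte_fin ltrD2r.
  by case: ifP => // _; rewrite -!EFinB; congr EFin; ring.
by apply/seteqP; split => z /=; rewrite !in_itv/= ltrBlDr lerBrDr.
Qed.

(** The flip exchanges the points with digit 0 and those with digit 1 by two opposite translations,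
    and Lebesgue measure is translation invariant. *)
Lemma Rintegral_flip a f : bmeas f ->
  \int[U]_x f (flip_digit a x) = \int[U]_x f x.
Proof.
move=> bf; apply/esym.
apply: Rintegral_measure_preserving bf; first exact: measurable_flip.
move=> X mX; rewrite /= /unif /mrestr.
have md : measurable [set x : RT | dig a x].
  rewrite (_ : [set _ | _] = (fun x : RT => (dig a x)%:R : R) @^-1` [set 1]).
    by rewrite -[X in measurable X]setTI; exact: measurable_dig.
  apply/seteqP; split => x /=; first by move=> ->.
  by case: (dig a x) => //= /eqP; rewrite eq_sym oner_eq0.
pose D := [set x : RT | dig a x].
have mI := @measurable_itv01 R.
have mXI : measurable (X `&` itv01) by exact: measurableI.
have mXD : measurable (X `&` itv01 `&` D) by exact: measurableI.
have mXC : measurable (X `&` itv01 `&` ~` D).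
  by apply: measurableI => //; exact: measurableC.
(* The preimage of [X] splits by the digit of the point: on [A] it is 0 and the flip moves right, on
   [B] it is 1 and the flip moves left. *)
pose A : set RT := (fun x : RT => x + 2 ^- a.+1) @^-1` (X `&` itv01 `&` D).
pose B : set RT := (fun x : RT => x - 2 ^- a.+1) @^-1` (X `&` itv01 `&` ~` D).
transitivity (lebesgue_measure A + lebesgue_measure B)%E; last first.
  rewrite (lebesgue_measure_shift (2 ^- a.+1) mXD).
  rewrite (lebesgue_measure_shift (- 2 ^- a.+1) mXC).
  rewrite -measureU//; last by rewrite setIACA setICr setI0.
  by rewrite -setIUr setUv setIT.
have mA : measurable A.
  by rewrite -[X in measurable X]setTI; exact: measurable_funD.
have mB : measurable B.
  by rewrite -[X in measurable X]setTI; exact: measurable_funD.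
have memI (z : R) : itv01 z = (0 <= z < 1) :> Prop.
  by rewrite /itv01 /= in_itv.
suff AB : flip_digit a @^-1` X `&` itv01 = A `|` B /\ A `&` B = set0.
  by rewrite AB.1 measureU//; exact: AB.2.
have AE x : A x -> (0 <= x < 1) /\ dig a x = false.
  rewrite /A /= memI => -[[_ y01] dy].
  have [[d _]|[y [z01 dz e _ [le _]]]] := flip_cases a y01.
    by move: d; rewrite -/(is_true _) dy.
  by rewrite (addIr _ e).
have BE x : B x -> (0 <= x < 1) /\ dig a x = true.
  rewrite /B /= memI => -[[_ y01] /negP/negbTE dy].
  have y0 : 0 <= x - 2 ^- a.+1 by case/andP: y01.
  have := dig_shift a y0; rewrite subrK dy /= => ->; split => //.
  have := low_lt1 y01 dy; rewrite subrK => ->; rewrite andbT (le_trans y0)//.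
  by rewrite lerBlDr lerDl ltW// pow2V_gt0.
split; last first.
  apply/seteqP; split => // x [/AE[_ d] /BE[_]]; by rewrite d.
apply/seteqP; split => x.
  rewrite /= memI => -[Xf x01].
  have [[d [e _]]|[y [y01 d xE e _]]] := flip_cases a x01.
    left; rewrite /A /= memI; split; last first.
      by rewrite /D /= dig_shift ?d//; case/andP: x01.
    rewrite -e; split => //; exact: flip_digit_itv.
  right; rewrite /B /= memI; rewrite xE addrK; split; last by rewrite /D /= d.
  by split => //; rewrite -e.
move=> [Ax|Bx].
  have [x01 d] := AE _ Ax; rewrite /= memI; split => //.
  have [[_ [-> _]]|[y [_ _ _ _ [_ d']]]] := flip_cases a x01.
    by move: Ax; rewrite /A /= => -[[]].
  by rewrite d in d'.
have [x01 d] := BE _ Bx; rewrite /= memI; split => //.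
have [[d' _]|[y [_ _ xE -> _]]] := flip_cases a x01; first by rewrite d in d'.
by move: Bx; rewrite /B /= xE addrK => -[[]].
Qed.

Lemma Rintegral_unif_itv (a b : R) : 0 <= a <= b -> b <= 1 ->
  \int[U]_x (a <= x < b)%R%:R = b - a.
Proof.
move=> ab b1; rewrite (_ : (fun x : RT => (a <= x < b)%R%:R) = \1_(`[a, b[%classic)).
  rewrite /Rintegral integral_indic// setIT [X in fine X](_ : _ = (b - a)%:E)//.
  exact: unif_itv.
by apply/funext => x; rewrite indicE mem_setE /= in_itv.
Qed.

Lemma Rintegral_cell b m : (m < 2 ^ b)%N ->
  \int[U]_x (cell b x == m)%:R = 2 ^- b.
Proof.
move=> mb; pose h : R := 2 ^- b; have h0 : 0 < h := pow2V_gt0 b.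
have e : 2 ^+ b * h = 1 :> R by rewrite mulfV// gt_eqF// pow2_gt0.
have mh : m.+1%:R * h <= 1.
  by rewrite -[leRHS]e ler_pM2r// -natrX ler_nat.
transitivity (\int[U]_x (m%:R * h <= x < m.+1%:R * h)%R%:R).
  apply: eq_Rintegral_unif; first exact: bmeas_cell_eq.
    apply: bmeas_indicator; rewrite (_ : [set _ | _] = `[m%:R * h, m.+1%:R * h[%classic).
      exact: measurable_itv.
    by apply/seteqP; split => x; rewrite /= in_itv.
  move=> x /andP[x0 _]; rewrite /cell truncn_eq; last first.
    by rewrite mulr_ge0// ltW// pow2_gt0.
  by rewrite [2 ^+ b * x]mulrC -ler_pdivrMr ?pow2_gt0// -ltr_pdivlMr ?pow2_gt0.
rewrite Rintegral_unif_itv//.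
  by rewrite -mulrBl -natr1 addrC addKr mul1r.
by rewrite mulr_ge0//= ?ler_pM2r ?ler_nat// ltW.
Qed.

Lemma Rintegral_win a x : 0 <= x < 1 -> \int[U]_u (win a x u)%:R = 2 ^- a.+1.
Proof.
move=> x01; have [l0 l1 _] := low_itv a x01.
rewrite Rintegral_unif_itv; first by rewrite addrC addKr.
  by rewrite l0 lerDl ltW// pow2V_gt0.
exact: ltW.
Qed.

End unif_integral.

(** * Integration by parts against Rademacher functions *)

Section kernel.
Context {R : realType}.
Local Notation RT := (measurableTypeR R).
Local Notation U := (@unif R).

(** The head of the list is the exponent used last, so the lists of interest are increasing. The
    factor [2^-1] comes from averaging over a flip, the integral from exchanging the order of
    integration against the window. *)
Fixpoint kern (l : seq nat) : RT -> R :=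
  if l is a :: l' then
    fun u => 2^-1 * \int[U]_x (kern l' x * (win a x u)%:R)
  else fun=> 1.

Definition kern_mean (l : seq nat) : R := \prod_(a <- l) 2 ^- (a + 2).

Lemma kern_mean_cons a l :
  kern_mean (a :: l) = 2^-1 * (kern_mean l * 2 ^- a.+1).
Proof. by rewrite /kern_mean big_cons addn2 exprS invfM mulrAC mulrA. Qed.

Lemma bmeas_kern_win a (f : RT -> R) : bmeas f ->
  bmeas (fun z : RT * RT => f z.1 * (win a z.1 z.2)%:R).
Proof.
move=> bf; apply: bmeasM; last exact: bmeas_win.
by apply: bmeas_comp bf; exact: measurable_fst.
Qed.

Lemma bmeas_kern l : bmeas (kern l).
Proof.
elim: l => [|a l IH]; first exact: bmeas_cst.
apply: bmeasM; first exact: bmeas_cst.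
exact: (bmeas_Rintegral_fst U U (bmeas_kern_win a IH)).
Qed.

Lemma kern_ge0 l x : 0 <= kern l x.
Proof.
elim: l x => [//|a l IH] x /=; rewrite mulr_ge0// Rintegral_ge0// => y _.
by rewrite mulr_ge0.
Qed.

Lemma bmeas_win_l a u : bmeas (fun x : RT => (win a x u)%:R : R).
Proof. exact: (bmeas_fst (bmeas_win a) u). Qed.

Lemma bmeas_win_r a x : bmeas (fun u : RT => (win a x u)%:R : R).
Proof. exact: (bmeas_snd (bmeas_win a) x). Qed.

(** After exchanging the integrals, [g u] becomes [g x] on the window of [x], whose length is
    [2 ^- a.+1]. Used with [g] constant, for the mean, and with [g] the indicator of a coarser
    cell. *)
Lemma Rintegral_kern_cons a l (g : RT -> R) : bmeas g ->
    (forall x u, 0 <= x < 1 -> win a x u -> g u = g x) ->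
  \int[U]_u (kern (a :: l) u * g u) =
  2^-1 * (\int[U]_x (kern l x * g x) * 2 ^- a.+1).
Proof.
move=> bg gw; have bk := bmeas_kern l.
pose F (z : RT * RT) := kern l z.1 * (win a z.1 z.2)%:R * g z.2.
have bF : bmeas F.
  apply: bmeasM; first exact: bmeas_kern_win.
  by apply: bmeas_comp bg; exact: measurable_snd.
transitivity (2^-1 * \int[U]_u \int[U]_x F (x, u)).
  rewrite -bmeas_RintegralZl; last exact: (bmeas_Rintegral_fst U U bF).
  apply: eq_Rintegral => u _ /=; rewrite -mulrA; congr (_ * _).
  rewrite -bmeas_RintegralZr//.
  by apply: bmeasM => //; exact: bmeas_win_l.
congr (_ * _); rewrite -(Rintegral_swap U U bF).
rewrite -bmeas_RintegralZr; last exact: bmeasM bk bg.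
apply: eq_Rintegral_unif; first exact: (bmeas_Rintegral_snd U U bF).
  by apply: bmeasM; [exact: bmeasM bk bg|exact: bmeas_cst].
move=> x x01; rewrite -(Rintegral_win a x01) -bmeas_RintegralZl; last exact: bmeas_win_r.
apply: eq_Rintegral => u _; rewrite /F /=.
have [/(gw _ _ x01) ->|_] := boolP (win a x u); last by rewrite !(mulr0, mul0r).
by rewrite !mulr1.
Qed.

Lemma Rintegral_kern l : \int[U]_x kern l x = kern_mean l.
Proof.
elim: l => [|a l IH]; first by rewrite Rintegral_prob_cst /kern_mean big_nil.
rewrite (@eq_Rintegral _ _ _ _ _ (fun x => kern (a :: l) x * 1)); last first.
  by move=> x _; rewrite mulr1.
rewrite Rintegral_kern_cons//; last exact: bmeas_cst.
rewrite (@eq_Rintegral _ _ _ _ _ (kern l)) ?IH ?kern_mean_cons// => x _.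
by rewrite mulr1.
Qed.

(** Windows of index above [b] never cross a boundary between cells of level [b], so the mass of the
    kernel inside a cell obeys the same recursion as its total mass. *)
Lemma Rintegral_kern_cell l b m : path ltn b l -> (m < 2 ^ b)%N ->
  \int[U]_x (kern l x * (cell b x == m)%:R) = kern_mean l * 2 ^- b.
Proof.
move=> + mb; elim: l => [_|a l IH /= /andP[ba al]].
  under eq_Rintegral do rewrite mul1r.
  by rewrite Rintegral_cell// /kern_mean big_nil mul1r.
rewrite Rintegral_kern_cons ?IH//.
- by rewrite kern_mean_cons; ring.
- exact: (path_le ltn_trans ba al).
- exact: bmeas_cell_eq.
move=> x u x01 w; have /andP[/andP[u0 _] /eqP c] := win_cell x01 w.
rewrite (@eq_cell_le _ a b u x)//; last exact: ltnW.
by case/andP: x01.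
Qed.

(* The window around [u] lies in the dyadic cell of [u], over which the previous
   kernel has its mean value. *)
Lemma kern_le l u : sorted ltn l -> 0 <= u < 1 -> kern l u <= 2 * kern_mean l.
Proof.
case: l => [_ _|a l /= al u01].
  by rewrite /kern_mean big_nil mulr1 ler1n.
have -> : 2 * kern_mean (a :: l) = 2^-1 * (kern_mean l * 2 ^- a).
  by rewrite kern_mean_cons exprS invfM; field; rewrite gt_eqF// pow2_gt0.
rewrite ler_pM2l ?invr_gt0//.
rewrite -(Rintegral_kern_cell al (cell_lt a u01)).
have bk := bmeas_kern l.
apply: le_Rintegral_unif.
- by apply: bmeasM => //; exact: bmeas_win_l.
- by apply: bmeasM => //; exact: bmeas_cell_eq.
move=> x x01; rewrite ler_wpM2l ?kern_ge0//.
have [/(win_cell x01)/andP[_]|_] := boolP (win a x u); last by [].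
by rewrite eq_sym => ->.
Qed.

(** Changing variables by the flip inside the integral, [win_flip] carries the claim from [l] to
    [a :: l]. *)
Lemma kern_flip l b u : all (ltn b) l -> 0 <= u < 1 ->
  kern l (flip_digit b u) = kern l u.
Proof.
move=> + u01; elim: l u u01 => [//|a l IH] u u01 /= /andP[ba bl].
have bk := bmeas_kern l.
congr (_ * _); rewrite -(@Rintegral_flip _ b); last first.
  by apply: bmeasM => //; exact: bmeas_win_l.
apply: eq_Rintegral_unif.
- apply: (bmeas_comp (f := fun x => kern l x * (win a x (flip_digit b u))%:R)).
    exact: measurable_flip.
  by apply: bmeasM => //; exact: bmeas_win_l.
- by apply: bmeasM => //; exact: bmeas_win_l.
by move=> x x01; rewrite IH// win_flip.
Qed.

(** Shaped after a slice of a function extended by clipping: continuous and bounded on the whole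
    line, but differentiable only on the open interval, as the extension may have a kink at 0 and
    1. *)
Definition C1_pair (F F' : R -> R) : Prop :=
  [/\ continuous F, continuous F', (exists M, forall t, `|F t| <= M),
    (exists M, forall t, `|F' t| <= M) &
    forall t : R, 0 < t < 1 -> is_derive t (1 : R) F (F' t)].

Lemma C1_pair_bmeas F F' : C1_pair F F' ->
  bmeas (F : RT -> R) /\ bmeas (F' : RT -> R).
Proof.
by move=> [cF cF' bF bF' _]; split; split => //; exact: continuous_measurable_fun.
Qed.

Lemma Rintegral_window F F' (l h : R) : C1_pair F F' ->
  0 <= l -> 0 < h -> l + h < 1 ->
  \int[U]_u (F' u * (l <= u < l + h)%R%:R) = F (l + h) - F l.
Proof.
move=> C l0 h0 lh1; have [_ [mF' _]] := C1_pair_bmeas C.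
have [cF cF' _ _ dF] := C.
rewrite /Rintegral; pose D : set RT := `[l, l + h[%classic.
pose f (u : RT) : R := F' u * (l <= u < l + h)%R%:R.
have -> : (\int[U]_u (f u)%:E = \int[U]_(u in D) (F' u)%:E)%E.
  rewrite [RHS]integral_mkcond; apply: eq_integral => u _.
  rewrite patchE /D mem_setE in_itv /f /=.
  by case: ifP; rewrite ?mulr1 ?mulr0.
rewrite (@eq_measure_integral _ _ _ _ (@lebesgue_measure R)); last first.
  move=> A mA Ac; rewrite /= /unif /mrestr setIidl// => x /Ac.
  rewrite /itv01 /= !in_itv/= => /andP[lx xl].
  by rewrite (le_trans l0 lx) (lt_trans xl lh1).
rewrite integral_itv_bndo_bndc; last first.
  by apply/measurable_EFinP; exact: measurable_funTS.
rewrite (@continuous_FTC2 _ F' F).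
- by rewrite -EFinB.
- by rewrite ltrDl.
- exact: continuous_subspaceT.
- split.
  + move=> x; rewrite in_itv/= => /andP[lx xl].
    have /dF[] // : 0 < x < 1 by rewrite (le_lt_trans l0 lx) (lt_trans xl lh1).
  + by apply: cvg_at_right_filter; exact: cF.
  + by apply: cvg_at_left_filter; exact: cF.
- move=> x; rewrite in_itv/= => /andP[lx xl].
  rewrite derive1E; apply: derive_val; apply: dF.
  by rewrite (le_lt_trans l0 lx) (lt_trans xl lh1).
Qed.

(** The flip preserves [G] and reverses the Rademacher sign, so the integral is also minus the one
    with [F] flipped; the right-hand side averages the two expressions. *)
Lemma Rintegral_rademacher_flip a (F G : RT -> R) : bmeas F -> bmeas G ->
    (forall x, 0 <= x < 1 -> G (flip_digit a x) = G x) ->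
  \int[U]_x (F x * (G x * rademacher a x)) =
  2^-1 * \int[U]_x ((F x - F (flip_digit a x)) * rademacher a x * G x).
Proof.
move=> bF bG Gf; have br := @bmeas_rademacher R a.
have bFf : bmeas (fun x : RT => F (flip_digit a x)).
  by apply: bmeas_comp bF; exact: measurable_flip.
have b1 : bmeas (fun x => F x * (G x * rademacher a x)).
  by apply: bmeasM => //; exact: bmeasM.
have b2 : bmeas (fun x => F (flip_digit a x) * (G x * rademacher a x)).
  by apply: bmeasM => //; exact: bmeasM.
have E : \int[U]_x (F (flip_digit a x) * (G x * rademacher a x)) =
    - \int[U]_x (F x * (G x * rademacher a x)).
  rewrite -(Rintegral_flip a b1) -bmeas_RintegralN; last first.
    by apply: bmeas_comp b1; exact: measurable_flip.
  apply: eq_Rintegral_unif => //.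
    by apply: bmeasN; apply: bmeas_comp b1; exact: measurable_flip.
  by move=> x x01; rewrite rademacher_flip// Gf// !mulrN opprK.
rewrite [in RHS](@eq_Rintegral _ _ _ _ _ (fun x => F x * (G x * rademacher a x) -
    F (flip_digit a x) * (G x * rademacher a x)))//; last by move=> x _; ring.
by rewrite bmeas_RintegralB// E; field.
Qed.

(* Pairing [x] with [flip_digit a x] turns [F] into a difference at distance
   [2 ^- a.+1], hence into an integral of [F'] over the window of [x]. *)
Lemma Rintegral_rademacher_by_parts a (F F' : RT -> R) (l : seq nat) (w : RT -> R) :
  C1_pair F F' -> bmeas w -> all (ltn a) l ->
  (forall x, 0 <= x < 1 -> w (flip_digit a x) = w x) ->
  (forall x u, 0 <= x < 1 -> win a x u -> w u = w x) ->
  \int[U]_x (F x * (kern l x * w x * rademacher a x)) =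
  - \int[U]_u (F' u * (kern (a :: l) u * w u)).
Proof.
move=> C bw al wf ww; have [bF bF'] := C1_pair_bmeas C.
have bk := bmeas_kern l; have bG := bmeasM bk bw.
rewrite (@Rintegral_rademacher_flip a F (fun x => kern l x * w x))//; last first.
  by move=> x x01; rewrite kern_flip// wf.
(* Integrated first in [u], it yields the increment of [F], as [w] is constant on the window;
   integrated first in [x], it yields the next kernel up to the factor [2^-1]. *)
pose H (z : RT * RT) := F' z.2 * w z.2 * (kern l z.1 * (win a z.1 z.2)%:R).
have bH : bmeas H.
  apply: bmeasM; last exact: bmeas_kern_win.
  apply: (bmeas_comp (f := fun u => F' u * w u)); first exact: measurable_snd.
  exact: bmeasM.
transitivity (2^-1 * - \int[U]_x \int[U]_u H (x, u)).
  congr (_ * _); rewrite -bmeas_RintegralN; last exact: (bmeas_Rintegral_snd U U bH).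
  apply: eq_Rintegral_unif.
  - apply: bmeasM => //; apply: bmeasM; last exact: bmeas_rademacher.
    by apply: bmeasB => //; apply: bmeas_comp bF; exact: measurable_flip.
  - by apply: bmeasN; exact: (bmeas_Rintegral_snd U U bH).
  move=> x x01; have [l0 l1 _] := low_itv a x01.
  transitivity (- \int[U]_u (F' u * (win a x u)%:R * (kern l x * w x))).
    rewrite bmeas_RintegralZr; last by apply: bmeasM => //; exact: bmeas_win_r.
    rewrite -mulNr (Rintegral_window C l0 (pow2V_gt0 _) l1) opprB.
    (* For either digit, the sign orients the difference the same way: [F] at the left end of the
       window minus [F] at the right end. *)
    congr (_ * _); have [[d [-> ->]]|[y [_ _ xE -> [-> d]]]] := flip_cases a x01.
      by rewrite /rademacher d expr0 mulr1.
    by rewrite /rademacher d expr1 mulrN1 opprB -xE.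
  congr (- _); apply: eq_Rintegral => u _; rewrite /H/=.
  have [/(ww _ _ x01) ->|_] := boolP (win a x u); last by rewrite !(mulr0, mul0r).
  by rewrite !mulr1; ring.
rewrite (Rintegral_swap U U bH) mulrN; congr (- _).
rewrite -bmeas_RintegralZl; last exact: (bmeas_Rintegral_fst U U bH).
apply: eq_Rintegral => u _; rewrite /H/=.
rewrite bmeas_RintegralZl; first by ring.
by apply: bmeasM => //; exact: bmeas_win_l.
Qed.

(** The factor of one coordinate after [n] integrations by parts, with [e] decreasing: the [n]
    largest exponents have gone into the kernel, the others still stand as signs. For [n = 0] it is
    the Walsh function. *)
Definition walsh_kern (e : seq nat) n (x : RT) : R :=
  kern (rev (take n e)) x * \prod_(a <- drop n e) rademacher a x.

Lemma bmeas_walsh_kern e n : bmeas (walsh_kern e n).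
Proof.
apply: bmeasM; first exact: bmeas_kern.
by apply: bmeas_prod => a; exact: bmeas_rademacher.
Qed.

Lemma walsh_kern_by_parts e n (F F' : RT -> R) : sorted gtn e -> (n < size e)%N ->
  C1_pair F F' ->
  \int[U]_x (F x * walsh_kern e n x) = - \int[U]_x (F' x * walsh_kern e n.+1 x).
Proof.
move=> se ne C; rewrite /walsh_kern (drop_nth 0%N ne) (take_nth 0%N ne) rev_rcons.
set a := nth 0%N e n; set l := rev _; set e2 := drop _ e.
(* Splitting [e] at [n] puts [a] below all exponents of the kernel ([al]) and above all remaining
   ones ([e2a]). *)
have : pairwise gtn e.
  by rewrite -sorted_pairwise// => y x z /= xy yz; exact: ltn_trans yz xy.
rewrite -{1}(cat_take_drop n e) (drop_nth 0%N ne) pairwise_cat => /and3P[+ _].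
rewrite allrel_consr => /andP[al _] /= /andP[e2a _].
pose w (x : RT) : R := \prod_(b <- e2) rademacher b x.
have bw : bmeas w by apply: bmeas_prod => b; exact: bmeas_rademacher.
rewrite -(Rintegral_rademacher_by_parts C bw).
- apply: eq_Rintegral => x _; rewrite big_cons /w; ring.
- by rewrite all_rev.
- move=> x x01; apply: eq_big_seq => b be.
  by rewrite /rademacher dig_flip_ltC//; exact: (allP e2a).
move=> x u x01 wu; have /andP[/andP[u0 _] /eqP c] := win_cell x01 wu.
apply: eq_big_seq => b be; rewrite /rademacher /dig (@eq_cell_le _ a b.+1 u x)//.
  by case/andP: x01.
exact: (allP e2a).
Qed.

Lemma walsh_kern_norm e n x : `|walsh_kern e n x| = kern (rev (take n e)) x.
Proof.
rewrite /walsh_kern normrM ger0_norm ?kern_ge0// normr_prod big1 ?mulr1// => a _.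
by rewrite /rademacher normr_sign.
Qed.

End kernel.

(** * Walsh functions *)

Section walsh_digits.
Context {R : realType}.
Local Notation RT := (measurableTypeR R).
Implicit Types (x : R) (b : nat -> bool).

Fixpoint prefix_num b n : nat :=
  if n is m.+1 then (prefix_num b m).*2 + b m else 0.

Lemma series_prefix_num b n :
  series (fun j => (b j)%:R * 2 ^- j.+1) n = (prefix_num b n)%:R * 2 ^- n :> R.
Proof.
elim: n => [|n IH]; first by rewrite seriesEnat/= big_geq// mul0r.
rewrite seriesSr IH /= natrD -mul2n natrM exprS.
by field; rewrite gt_eqF// pow2_gt0.
Qed.

Lemma cell_prefix_num x n : 0 <= x < 1 ->
  cell n x = prefix_num (fun j => dig j x) n.
Proof.
move=> x01; have x0 : 0 <= x by case/andP: x01.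
elim: n => [|n IH] /=.
  by have := cell_lt 0 x01; rewrite expn0 ltnS leqn0 => /eqP.
by rewrite -IH (cell_half n x0) /dig addnC odd_double_half.
Qed.

Lemma dig_is_binary_expansion x : 0 <= x < 1 ->
  is_binary_expansion x (fun j => dig j x).
Proof.
move=> x01; have x0 : 0 <= x by case/andP: x01.
have bnd n : (cell n x)%:R * 2 ^- n <= x < ((cell n x)%:R + 1) * 2 ^- n.
  rewrite ler_pdivrMr ?pow2_gt0// ltr_pdivlMr ?pow2_gt0// natr1 [x * _]mulrC.
  exact: cellP.
have cv0 : (2 ^- n : R) @[n --> \oo] --> (0 : R).
  under eq_fun do rewrite -exprVn.
  by apply: cvg_expr; rewrite ger0_norm// invf_lt1// ltr1n.
split.
  rewrite (_ : series _ = fun n => (cell n x)%:R * 2 ^- n); last first.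
    by apply/funext => n; rewrite series_prefix_num cell_prefix_num.
  apply: (@squeeze_cvgr _ _ _ _ (fun n => x - 2 ^- n) (fun=> x)).
  - apply: nearW => n; have /andP[-> h] := bnd n.
    by rewrite andbT lerBlDr ltW// (lt_le_trans h)// mulrDl mul1r.
  - by rewrite -[X in _ --> X]subr0; apply: cvgB => //; exact: cvg_cst.
  - exact: cvg_cst.
move=> m; apply: contrapT => nz.
have ones j : (m <= j)%N -> dig j x = true.
  by move=> mj; case E : (dig j x) => //; case: nz; exists j.
(* If all digits from [m] on were 1, [x] would lie within [2 ^- (m + n)] of the right end of its
   cell of level [m] for every [n], whereas that end is at a positive distance [d]. *)
have grow n : ((cell (m + n) x).+1 = 2 ^ n * (cell m x).+1)%N.
  elim: n => [|n IH]; first by rewrite addn0 expn0 mul1n.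
  rewrite expnS -mulnA -IH addnS.
  have := odd_double_half (cell (m + n).+1 x).
  rewrite -/(dig (m + n) x) ones ?leq_addr// -cell_half//.
  move: (cell _ _) (cell _ _) (2 ^ n)%N => p q r; lia.
have /andP[_ lt] := bnd m.
pose d := ((cell m x)%:R + 1) * 2 ^- m - x.
have d0 : 0 < d by rewrite subr_gt0.
have dle n : d <= 2 ^- (m + n).
  rewrite /d lerBlDr -lerBlDl; have /andP[+ _] := bnd (m + n)%N.
  apply: le_trans.
  have E : (cell (m + n) x)%:R + 1 = 2 ^+ n * ((cell m x)%:R + 1) :> R.
    by rewrite !natr1 grow natrM natrX.
  have -> : (cell (m + n) x)%:R = 2 ^+ n * ((cell m x)%:R + 1) - 1 :> R.
    by rewrite -E addrK.
  rewrite exprD le_eqVlt; apply/orP; left; apply/eqP.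
  by field; rewrite !gt_eqF// pow2_gt0.
have /cvgrPdist_lt/(_ _ d0)[n _ /(_ (m + n)%N)] := cv0.
rewrite /= leq_addl => /(_ isT).
rewrite sub0r normrN gtr0_norm ?pow2V_gt0// => /(le_lt_trans (dle n)).
by rewrite ltxx.
Qed.

Lemma binary_expansion_unique x b : 0 <= x < 1 ->
  is_binary_expansion x b -> b =1 fun j => dig j x.
Proof.
move=> x01 [cvS zeros].
pose S := series (fun j => (b j)%:R * 2 ^- j.+1 : R).
have x0 : 0 <= x by case/andP: x01.
have Sn n : S n.+1 = S n + (b n)%:R * 2 ^- n.+1 by rewrite /S seriesSr.
have ndS : nondecreasing_seq S.
  apply/nondecreasing_seqP => n; by rewrite Sn lerDl mulr_ge0.
have Sle n : S n <= x.
  rewrite -(cvg_lim _ cvS)//; apply: nondecreasing_cvgn_le => //.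
  by apply/cvg_ex; exists x.
(* [S n] and [T n] enclose [x]. The bound [x < T n] is strict because [T] drops strictly below the
   limit's upper bounds at a digit 0 with index [j >= n]; hence [cell n x] is the prefix number. *)
pose T n := S n + 2 ^- n.
have pV n : 2 ^- n = 2 * 2 ^- n.+1 :> R.
  by rewrite exprS; field; rewrite gt_eqF// pow2_gt0.
have pV0 n : 0 < 2 ^- n :> R := pow2V_gt0 n.
have niT : nonincreasing_seq T.
  apply/nonincreasing_seqP => n; rewrite /T Sn (pV n) -addrA lerD2l.
  have := pV0 n.+1; case: (b n) => /= ?; lra.
have xT n : x < T n.
  have [j nj bj] := zeros n.
  apply: (@le_lt_trans _ _ (T j.+1)); last first.
    apply: (@lt_le_trans _ _ (T j)); last exact: niT.
    by rewrite /T Sn bj mul0r addr0 ltrD2l (pV j); have := pV0 j.+1; lra.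
  rewrite -(cvg_lim _ cvS)//; apply: limr_le.
    by apply/cvg_ex; exists x.
  exists j.+1 => // m /= jm; apply: le_trans (niT _ _ jm).
  by rewrite /T lerDl ltW.
have cE n : cell n x = prefix_num b n.
  apply: cell_def; rewrite -ler_pdivrMl ?pow2_gt0// -ltr_pdivlMl ?pow2_gt0//.
  rewrite ![2 ^- n * _]mulrC -series_prefix_num Sle/=.
  by rewrite -natr1 mulrDl mul1r -series_prefix_num; exact: xT.
by move=> j; rewrite /dig cE /= oddD odd_double oddb.
Qed.

Lemma binary_digitsE x j : 0 <= x < 1 -> binary_digits x j = dig j x.
Proof.
move=> x01; apply: (binary_expansion_unique x01); rewrite /binary_digits.
by apply: xgetPex; exists (fun j => dig j x); exact: dig_is_binary_expansion.
Qed.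

Lemma walsh1E k x : 0 <= x < 1 -> walsh1 k x = walsh_kern (exponents k) 0 x.
Proof.
move=> x01; rewrite /walsh_kern take0 drop0 /= mul1r /exponents big_filter.
rewrite [RHS]big_mkcond (perm_big (iota 0 k)) ?perm_rev//=.
have -> : iota 0 k = index_iota 0 k by rewrite /index_iota subn0.
rewrite big_mkord /walsh1.
rewrite (big_morph (fun n => (-1) ^+ n : R) (exprD _) (expr0 _)).
apply: eq_bigr => j _; rewrite binary_digitsE//.
by case: odd; rewrite ?mul1n// mul0n expr0.
Qed.

End walsh_digits.

(** * Continuous functions on the closed cube *)

Section continuous_on_cube.
Context {R : realType}.
Local Notation RT := (measurableTypeR R).

Lemma cvg_row (T : Type) (F : set_system T) n (phi : T -> 'rV[R]_n) (M : 'rV[R]_n) :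
  Filter F -> (forall j, phi t ord0 j @[t --> F] --> M ord0 j) ->
  phi @ F --> M.
Proof.
move=> FF h A [P MP sPA]; rewrite /= nbhs_simpl.
have : \forall t \near F, forall j, P ord0 j (phi t ord0 j).
  by apply: filter_forall => j; exact: h.
by apply: filterS => t Pt; apply: sPA => i j; rewrite ord1.
Qed.

Definition clip (t : R) : R := if t < 0 then 0 else if t < 1 then t else 1.

Lemma clip_itv t : 0 <= clip t <= 1.
Proof.
rewrite /clip; have [t0|t0] := ltP t 0; first by rewrite lexx ler01.
by have [/ltW t1|t1] := ltP t 1; rewrite ?t0 ?t1 ?ler01 ?lexx.
Qed.

Lemma clip_id t : 0 <= t <= 1 -> clip t = t.
Proof.
rewrite /clip => /andP[t0 t1]; rewrite ltNge t0 /=.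
by case: ltP => // ?; apply/le_anti/andP.
Qed.

Lemma continuous_clip : continuous clip.
Proof.
move=> t; apply/cvgrPdist_le => e e0.
apply/nbhs_ballP; exists e => //= u; rewrite /ball/= => /ltW; apply: le_trans.
have := ler_norm (t - u); have := ler_norm (u - t); rewrite (distrC u t) /clip.
have [?|?] := ltP t 0; have [?|?] := ltP u 0; have [?|?] := ltP t 1;
  have [?|?] := ltP u 1; rewrite ler_norml; lra.
Qed.

Definition clip_row n (x : 'rV[R]_n) : 'rV[R]_n := \row_j clip (x ord0 j).

Lemma clip_row_cube n (x : 'rV[R]_n) : closed_cube (clip_row x).
Proof. by move=> i; rewrite mxE clip_itv. Qed.

Lemma clip_row_id n (x : 'rV[R]_n) : closed_cube x -> clip_row x = x.
Proof. by move=> h; apply/rowP => j; rewrite mxE clip_id. Qed.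

(* The continuous extension of [g] from the closed cube to all tuples. *)
Definition cube_ext n (g : 'rV[R]_n -> R) (x : n.-tuple RT) : R :=
  g (clip_row (row_of_tuple x)).

Lemma cube_extE n (g : 'rV[R]_n -> R) x : @unit_cube R n x ->
  cube_ext g x = g (row_of_tuple x).
Proof.
move=> x01; rewrite /cube_ext clip_row_id// => i.
by rewrite mxE; have /andP[-> /ltW] := x01 i.
Qed.

Section within.
Context {n : nat} (g : 'rV[R]_n -> R).
Hypothesis cg : {within @closed_cube R n, continuous g}.

(** An arbitrary filter serves both the continuity of slices and the convergence of dyadic
    approximations. *)
Lemma cvg_cube_ext (T : Type) (F : set_system T) (phi : T -> 'rV[R]_n)
    (M : 'rV[R]_n) : Filter F ->
  (forall j, phi t ord0 j @[t --> F] --> M ord0 j) ->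
  g (clip_row (phi t)) @[t --> F] --> g (clip_row M).
Proof.
move=> FF h; have /subspace_continuousP/(_ _ (clip_row_cube M)) := cg.
apply: cvg_trans => /= A.
rewrite /= !nbhs_simpl /= /within/= => gA.
suff: clip_row (phi t) @[t --> F] --> clip_row M.
  move=> /(_ _ gA); rewrite nbhs_simpl/=; apply: filterS => t; apply.
  exact: clip_row_cube.
apply: cvg_row => j.
under eq_fun do rewrite mxE.
rewrite mxE; apply: continuous_cvg; [exact: continuous_clip|exact: h].
Qed.

Lemma cube_ext_bounded : exists M, forall x, `|cube_ext g x| <= M.
Proof.
have /compact_bounded[M [_ h]] : compact (g @` @closed_cube R n).
  apply: continuous_compact => //.
  have -> : @closed_cube R n = [set v | forall i, (fun=> `[0, 1]%classic) i (v ord0 i)].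
    by apply/seteqP; split => x /= h i; have := h i; rewrite in_itv.
  apply: (@rV_compact R n (fun=> `[0, 1]%classic)) => i; exact: segment_compact.
exists (M + 1) => x; apply: h; first by rewrite ltrDl.
by exists (clip_row (row_of_tuple x)) => //; exact: clip_row_cube.
Qed.

(** Links the product sigma-algebra on tuples with the topology on row vectors: clipped coordinates,
    rounded down to multiples of [2 ^- m], give step functions that converge to the clipped
    point. *)
Definition round_row m (x : n.-tuple RT) : 'rV[R]_n :=
  \row_j ((cell m (clip (tnth x j)))%:R * 2 ^- m).

(** [clip] reaches the value 1, whose cell index is [2 ^ m] itself, hence [2 ^ m + 1] possible
    values. *)
Lemma cell_clip_lt m t : (cell m (clip t) < (2 ^ m).+1)%N.
Proof.
have /andP[c0 c1] := clip_itv t; rewrite ltnS -(ler_nat R).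
have /andP[h _] := cellP m c0; apply: le_trans h _.
by rewrite natrX -[leRHS]mulr1 ler_pM2l// pow2_gt0.
Qed.

(** [round_row m] takes finitely many values, each on a box of measurable sides. *)
Lemma measurable_round_row m (h : 'rV[R]_n -> R) :
  measurable_fun setT (fun x => h (round_row m x)).
Proof.
pose I := {ffun 'I_n -> 'I_(2 ^ m).+1}.
pose row_of (c : I) : 'rV[R]_n := \row_j ((c j)%:R * 2 ^- m).
pose idx (x : n.-tuple RT) : I := [ffun j => Ordinal (cell_clip_lt m (tnth x j))].
have rE x : round_row m x = row_of (idx x).
  by apply/rowP => j; rewrite !mxE ffunE.
move=> _ Y mY; rewrite setTI.
rewrite (_ : _ @^-1` _ = \bigcup_(c in [set c : I | Y (h (row_of c))])
    box (fun j => [set t | cell m (clip t) = c j])).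
  apply: fin_bigcup_measurable; first exact: finite_finset.
  move=> c _; apply: measurable_box => j.
  rewrite (_ : [set _ | _] = (fun t : RT => (cell m (clip t))%:R : R) @^-1`
      [set (c j)%:R]).
    rewrite -[X in measurable X]setTI.
    apply: (measurableT_comp (measurable_cell m)) => //.
    by apply: continuous_measurable_fun; exact: continuous_clip.
  apply/seteqP; split => t /=; first by move=> ->.
  by move=> /eqP; rewrite eqr_nat => /eqP.
apply/seteqP; split => x /=.
  rewrite rE => Yx; exists (idx x) => // j.
  by rewrite /= ffunE.
move=> [c Yc xc]; rewrite rE (_ : idx x = c)//.
by apply/ffunP => j; rewrite ffunE; apply: val_inj; exact: xc.
Qed.

Lemma bmeas_cube_ext : bmeas (cube_ext g).
Proof.
split; last exact: cube_ext_bounded.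
apply: (@measurable_fun_cvg _ _ _ _
  (fun m x => g (clip_row (round_row m x)))).
  by move=> m; exact: (measurable_round_row m (fun y => g (clip_row y))).
move=> x _; rewrite /cube_ext -[X in g X](clip_row_id (clip_row_cube _)).
apply: cvg_cube_ext => j.
rewrite !mxE; under eq_fun do rewrite mxE.
set t := clip _; have /andP[t0 _] : 0 <= t <= 1 := clip_itv _.
apply: (@squeeze_cvgr _ _ _ _ (fun m => t - 2 ^- m) (fun=> t)).
- apply: nearW => m; have /andP[h1 h2] := cellP m t0.
  rewrite ler_pdivrMr ?pow2_gt0// [t * _]mulrC h1 andbT lerBlDr.
  rewrite -[X in _ + X]mul1r -mulrDl ler_pdivlMr ?pow2_gt0// mulrC natr1.
  exact: ltW.
- rewrite -[X in _ --> X]subr0; apply: cvgB; first exact: cvg_cst.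
  under eq_fun do rewrite -exprVn.
  by apply: cvg_expr; rewrite ger0_norm// invf_lt1// ltr1n.
- exact: cvg_cst.
Qed.

End within.

Lemma row_of_upd n (x : n.-tuple RT) i t :
  row_of_tuple (upd x i t) = set_coord (row_of_tuple x) i t.
Proof. by apply/rowP => j; rewrite !mxE tnth_mktuple. Qed.

Lemma C1_pair_slice n (g : 'rV[R]_n -> R) (i : 'I_n) (x : n.-tuple RT) :
  has_partial i g ->
  {within @closed_cube R n, continuous g} ->
  {within @closed_cube R n, continuous (partial i g)} ->
  C1_pair (fun t => cube_ext g (upd x i t))
          (fun t => cube_ext (partial i g) (upd x i t)).
Proof.
move=> hg cg cg'.
have cslice h : {within @closed_cube R n, continuous h} ->
    continuous (fun t => cube_ext h (upd x i t)).
  move=> ch t; rewrite /continuous_at /cube_ext.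
  under eq_fun do rewrite row_of_upd.
  rewrite row_of_upd; apply: cvg_cube_ext => // j; rewrite mxE.
  under eq_fun do rewrite mxE.
  by case: ifP => _; [exact: cvg_id|exact: cvg_cst].
split; [exact: cslice|exact: cslice| | |].
- by have [M hM] := cube_ext_bounded cg; exists M.
- by have [M hM] := cube_ext_bounded cg'; exists M.
move=> t /andP[t0 t1].
pose X := clip_row (row_of_tuple x).
have FE u : 0 <= u <= 1 -> clip_row (row_of_tuple (upd x i u)) = set_coord X i u.
  move=> u01; apply/rowP => j; rewrite row_of_upd !mxE.
  by case: ifP => // _; rewrite clip_id.
have t01 : 0 <= t <= 1 by rewrite !ltW.
have Xt : closed_cube (set_coord X i t).
  by rewrite -FE//; exact: clip_row_cube.
have Xtt : (set_coord X i t) ord0 i = t by rewrite mxE eqxx.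
have := hg _ Xt; rewrite /partial_filter Xtt => /cvgP hcv.
set l := cube_ext (partial i g) _.
have {}hcv : diff_quotient i g (set_coord X i t) u
    @[u --> within `[0, 1] t^'] --> l.
  by rewrite /l /cube_ext FE// /partial /partial_filter Xtt.
suff H : (fun h : R => h^-1 *: (cube_ext g (upd x i (h *: 1 + t)) -
    cube_ext g (upd x i t))) @ 0^' --> l.
  by apply: DeriveDef; [apply/cvg_ex; exists l|exact: cvg_lim].
apply/cvgrPdist_lt => e e0.
move/cvgrPdist_lt : hcv => /(_ e e0) /nbhs_ballP [d /= d0 hd].
(* This radius keeps [h + t] in [0,1], so at the interior point [t] the limit within [0,1] is the
   full two-sided derivative. *)
apply/nbhs_ballP; exists (Num.min d (Num.min t (1 - t))).
  by rewrite /= !lt_min d0 t0 subr_gt0.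
move=> /= h; rewrite /ball/= sub0r normrN !lt_min => /and3P[hd' ht ht1] h0.
have /andP[h1 h2] : - `|h| <= h <= `|h| by rewrite -ler_norml.
have u01 : 0 <= h + t <= 1 by apply/andP; split; lra.
have bh : ball t d (h + t).
  by rewrite /ball/= opprD addrA addrAC subrr sub0r normrN.
have ht0 : h + t != t by rewrite -subr_eq0 addrK.
have Iht : `[0, 1]%classic (h + t) by rewrite /= in_itv.
have := hd _ bh ht0 Iht.
have hA : h%:A = h :> R by exact: mulr1.
have htK : h + t - t = h :> R by exact: addrK.
rewrite /diff_quotient Xtt /cube_ext !FE ?hA ?htK//.
have -> : set_coord (set_coord X i t) i (h + t) = set_coord X i (h + t).
  by apply/rowP => j; rewrite !mxE; case: eqP.
by rewrite [_ *: _]mulrC.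
Qed.

End continuous_on_cube.

(** * Integration by parts on the cube *)

Section diff_vars_order.
Context {s : nat}.
Implicit Types (w : seq 'I_s) (n : s.-tuple nat).

Let leI (i j : 'I_s) := (i <= j)%N.

Let leI_trans : transitive leI. Proof. by move=> j i k; exact: leq_trans. Qed.

Lemma diff_vars_sorted n : sorted leI (diff_vars n).
Proof.
rewrite sorted_pairwise// /diff_vars.
have : pairwise leI (enum 'I_s).
  rewrite -sorted_pairwise//.
  have := iota_sorted 0 s; rewrite -val_enum_ord.
  by rewrite sorted_map.
elim: (enum 'I_s) => [//|i r IH] /= /andP[ir /IH rr].
rewrite pairwise_cat rr andbT; apply/andP; split.
  apply/allrelP => j k /nseqP[-> _] /flatten_mapP[k' k'r /nseqP[-> _]].
  exact: (allP ir).
rewrite -sorted_pairwise//; elim: (tnth n i) => [//|[//|m] IHm] /=.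
by rewrite /leI leqnn.
Qed.

Lemma count_diff_vars n j : count_mem j (diff_vars n) = tnth n j.
Proof.
rewrite /diff_vars.
have H r : uniq r -> count_mem j (flatten [seq nseq (tnth n i) i | i <- r]) =
    ((j \in r) * tnth n j)%N.
  elim: r => [//|i r IH] /= /andP[ir ur].
  rewrite count_cat IH// count_nseq in_cons /= [j == i]eq_sym.
  have [<-|ij] /= := eqVneq i j; last by rewrite mul0n.
  by rewrite (negbTE ir) !mul1n mul0n addn0.
by rewrite H ?enum_uniq// mem_enum mul1n.
Qed.

Lemma sorted_diff_vars w : sorted leI w ->
  w = diff_vars [tuple count_mem i w | i < s].
Proof.
move=> sw; apply: (sorted_eq leI_trans) => //.
- by move=> i j; rewrite /leI -eqn_leq => /eqP/val_inj.
- exact: diff_vars_sorted.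
rewrite /perm_eq; apply/allP => j _ /=.
by rewrite count_diff_vars tnth_mktuple.
Qed.

(** Integration by parts starts from the innermost derivative, so it meets the derivatives along
    suffixes of [diff_vars n]. A suffix of a sorted list is sorted, hence it is the list of a
    smaller multi-index, which the hypothesis on [f] covers. *)
Lemma diff_vars_suffix n w1 w2 : diff_vars n = w1 ++ w2 ->
  exists2 m : s.-tuple nat, w2 = diff_vars m & forall i, (tnth m i <= tnth n i)%N.
Proof.
move=> E; have := diff_vars_sorted n; rewrite E => sw.
exists [tuple count_mem i w2 | i < s].
  by apply: sorted_diff_vars; case/cat_sorted2: sw.
move=> i; rewrite tnth_mktuple -[leqRHS]count_diff_vars E count_cat.
exact: leq_addl.
Qed.

End diff_vars_order.

Section cube_by_parts.
Context {R : realType} {s : nat}.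
Local Notation RT := (measurableTypeR R).
Local Notation U := (@unif R).
Local Notation P := (@cube_prob R s).

(** Fubini along coordinate [i] reduces this to the one-dimensional rule in the last hypothesis; [B]
    is constant on slices and factors out. *)
Lemma cube_by_parts (g : 'rV[R]_s -> R) (i : 'I_s) (Psi Theta : RT -> R)
    (B : s.-tuple RT -> R) :
  has_partial i g ->
  {within @closed_cube R s, continuous g} ->
  {within @closed_cube R s, continuous (partial i g)} ->
  bmeas Psi -> bmeas Theta -> bmeas B ->
  (forall x t, B (upd x i t) = B x) ->
  (forall F F', C1_pair F F' ->
    \int[U]_t (F t * Psi t) = - \int[U]_t (F' t * Theta t)) ->
  \int[P]_x (cube_ext g x * (Psi (tnth x i) * B x)) =
  - \int[P]_x (cube_ext (partial i g) x * (Theta (tnth x i) * B x)).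
Proof.
move=> hg cg cg' bP bT bB BE ibp.
have bE h (K : RT -> R) : {within @closed_cube R s, continuous h} -> bmeas K ->
    bmeas (fun x => cube_ext h x * (K (tnth x i) * B x)).
  move=> ch bK; apply: bmeasM; first exact: bmeas_cube_ext.
  by apply: bmeasM => //; apply: bmeas_comp bK; exact: measurable_tnth.
have tE x t : tnth (upd x i t) i = t :> RT by rewrite tnth_mktuple eqxx.
have bs h x : {within @closed_cube R s, continuous h} ->
    bmeas (fun t : RT => cube_ext h (upd x i t)).
  move=> ch; have bh := bmeas_cube_ext ch.
  exact: (bmeas_snd (bmeas_upd i bh) x).
rewrite (Rintegral_cube_upd i (bE _ _ cg bP)) (Rintegral_cube_upd i (bE _ _ cg' bT)).
rewrite -bmeas_RintegralN; last first.
  exact: (bmeas_Rintegral_snd P U (bmeas_upd i (bE _ _ cg' bT))).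
apply: eq_Rintegral => x _.
transitivity (\int[U]_t (cube_ext g (upd x i t) * Psi t * B x)).
  by apply: eq_Rintegral => t _; rewrite tE BE mulrA.
rewrite bmeas_RintegralZr; last by apply: bmeasM => //; exact: bs.
rewrite (ibp _ _ (C1_pair_slice x hg cg cg')) mulNr; congr (- _).
rewrite -bmeas_RintegralZr; last by apply: bmeasM => //; exact: bs.
by apply: eq_Rintegral => t _; rewrite tE BE mulrA.
Qed.

Variable e : 'I_s -> seq nat.

Definition cube_kern (m : 'I_s -> nat) (x : s.-tuple RT) : R :=
  \prod_i walsh_kern (e i) (m i) (tnth x i).

Lemma bmeas_cube_kern m : bmeas (cube_kern m).
Proof.
apply: bmeas_prod => i; apply: bmeas_comp (bmeas_walsh_kern _ _).
exact: measurable_tnth.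
Qed.

Hypothesis sorted_e : forall i, sorted gtn (e i).

Lemma cube_kern_by_parts (g : 'rV[R]_s -> R) (i : 'I_s) (m m' : 'I_s -> nat) :
  has_partial i g ->
  {within @closed_cube R s, continuous g} ->
  {within @closed_cube R s, continuous (partial i g)} ->
  (m i < size (e i))%N ->
  (forall j, m' j = (i == j) + m j)%N ->
  \int[P]_x (cube_ext g x * cube_kern m x) =
  - \int[P]_x (cube_ext (partial i g) x * cube_kern m' x).
Proof.
move=> hg cg cg' mi m'E.
pose B (x : s.-tuple RT) := \prod_(j | j != i) walsh_kern (e j) (m j) (tnth x j) : R.
have kE x : cube_kern m x = walsh_kern (e i) (m i) (tnth x i) * B x.
  by rewrite /cube_kern (bigD1 i).
have kE' x : cube_kern m' x = walsh_kern (e i) (m i).+1 (tnth x i) * B x.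
  rewrite /cube_kern (bigD1 i)//= m'E eqxx; congr (_ * _).
  by apply: eq_bigr => j ji; rewrite m'E eq_sym (negbTE ji).
have bB : bmeas B.
  rewrite (_ : B = fun x => \prod_j (if j != i then
      walsh_kern (e j) (m j) (tnth x j) else 1)); last first.
    by apply/funext => x; rewrite /B big_mkcond.
  apply: bmeas_prod => j; case: (j != i); last exact: bmeas_cst.
  by apply: bmeas_comp (bmeas_walsh_kern _ _); exact: measurable_tnth.
under eq_Rintegral => x _ do rewrite kE.
under [in RHS]eq_Rintegral => x _ do rewrite kE'.
apply: cube_by_parts => //; [exact: bmeas_walsh_kern..| |].
  move=> x t; apply: eq_bigr => j ji.
  by rewrite tnth_mktuple (negbTE ji).
move=> F F'; exact: walsh_kern_by_parts.
Qed.

(** Each occurrence of [i] in [w] uses up one exponent of coordinate [i], so its count is the index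
    of the kernel there. Absolute values absorb one sign per step. *)
Lemma cube_kern_by_parts_iter (f : 'rV[R]_s -> R) (w : seq 'I_s) :
  has_partials w f ->
  (forall w1 w2, w = w1 ++ w2 ->
    {within @closed_cube R s, continuous (foldr partial f w2)}) ->
  (forall i, count_mem i w <= size (e i))%N ->
  `|\int[P]_x (cube_ext f x * cube_kern (fun=> 0%N) x)| =
  `|\int[P]_x (cube_ext (foldr partial f w) x * cube_kern (fun j => count_mem j w) x)|.
Proof.
elim: w => [//|i w IH] /= [hw hi] cw nw.
rewrite IH//; last 2 first.
- by move=> w1 w2 E; apply: (cw (i :: w1)); rewrite E.
- by move=> j; apply: leq_trans (nw j); exact: leq_addl.
rewrite (@cube_kern_by_parts _ i _ (fun j => count_mem j (i :: w)))// ?normrN//.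
- exact: (cw [:: i] _ erefl).
- exact: (cw [::] (i :: w) erefl).
- by apply: leq_trans (nw i); rewrite eqxx.
Qed.

End cube_by_parts.

(** * Hoelder's inequality with a weight *)

Section weighted_Lnorm.
Context {d} {T : measurableType d} {R : realType} (mu : {measure set T -> \bar R}).
Variables (f g : T -> R) (M c : R).
Hypotheses (mf : measurable_fun setT f) (mg : measurable_fun setT g).
Hypotheses (g0 : forall x, 0 <= g x) (gM : forall x, g x <= M * c).
Hypotheses (M0 : 0 < M) (c0 : 0 < c) (gc : (\int[mu]_x (g x)%:E = c%:E)%E).
Hypothesis mu0 : (0 < mu setT)%E.

(** Pointwise, [g ^ q] is at most [(M * c) ^ (q - 1) * g]. After integration and the root of order
    [q], the exponents [1 - 1/q] and [1/q] of [c] add up to 1. *)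
Lemma Lnorm_weight_le q : 1 < q ->
  ('N[mu]_q%:E[EFin \o g] <= (M `^ (1 - q^-1) * c)%:E)%E.
Proof.
move=> q1; have q0 : 0 < q by apply: lt_trans q1.
have -> : (M `^ (1 - q^-1) * c)%:E = (((M * c) `^ (q - 1) * c)%:E `^ q^-1)%E.
  rewrite poweR_EFin powRM ?powR_ge0 ?(ltW c0)//.
  rewrite -powRrM mulrBl mulfV ?gt_eqF// mul1r.
  rewrite powRM ?(ltW M0) ?(ltW c0)// -mulrA -powRD ?subrK ?powRr1 ?(ltW c0)//.
  by rewrite gt_eqF// implybT.
rewrite unlock; apply: gt0_ler_poweR.
- by rewrite invr_ge0 ltW.
- rewrite in_itv/= leey andbT; apply: integral_ge0 => x _.
  by rewrite lee_fin powR_ge0.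
- by rewrite in_itv/= leey andbT lee_fin mulr_ge0// ?powR_ge0// ltW.
rewrite EFinM -gc -ge0_integralZl//; last 3 first.
- exact/measurable_EFinP.
- by move=> x _; rewrite lee_fin.
- by rewrite lee_fin powR_ge0.
apply: ge0_le_integral => //.
- by move=> x _; rewrite poweR_EFin lee_fin powR_ge0.
- under eq_fun do rewrite poweR_EFin; apply/measurable_EFinP.
  apply: (measurableT_comp (measurable_powR q)).
  exact: measurableT_comp.
- apply/measurable_EFinP; apply: measurable_funM => //.
move=> x _; rewrite poweR_EFin lee_fin ger0_norm//.
have [->|gx0] := eqVneq (g x) 0; first by rewrite powR0 ?mulr0// gt_eqF.
rewrite -{1}(subrK 1 q) powRD; last by rewrite gx0 implybT.
rewrite powRr1// ler_wpM2r// ge0_ler_powR ?nnegrE ?subr_ge0 ?(ltW q1)//.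
by rewrite mulr_ge0// ltW.
Qed.

(** For [1 < p < oo], Hoelder with the conjugate exponent [q], where [1 - 1/q = 1/p] is the power of
    [M] in the previous bound. The two ends are direct: for [p = 1] the weight is at most [M * c],
    for [p = oo] its mean [c] enters. *)
Lemma integral_weight_le_Lnorm (p : \bar R) : (1 <= p)%E ->
  (\int[mu]_x (`|f x| * g x)%:E <=
   (M `^ (fine p^-1) * c)%:E * 'N[mu]_p[EFin \o f])%E.
Proof.
have mfg : measurable_fun setT (fun x => (`|f x| * g x)%:E).
  apply/measurable_EFinP; apply: measurable_funM => //; exact: measurableT_comp.
have mfa : measurable_fun setT (fun x => `|f x|%:E).
  by apply/measurable_EFinP; exact: measurableT_comp.
case: p => [p|_|//]; last first.
  rewrite invey powRr0 mul1r unlock /= mu0; set E := ess_sup _ _.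
  have hE := ess_sup_ge mu (abse \o (EFin \o f)).
  have E0 : (0 <= E)%E.
    apply: ess_sup_gee => //; apply: nearW => x.
    by rewrite /= lee_fin.
  rewrite muleC -gc -ge0_integralZl//; last 2 first.
  - exact/measurable_EFinP.
  - by move=> x _; rewrite lee_fin.
  apply: ae_ge0_le_integral => //.
  - by move=> x _; rewrite lee_fin mulr_ge0.
  - by move=> x _; rewrite mule_ge0// lee_fin.
  - by apply: emeasurable_funM => //; exact/measurable_EFinP.
  apply: filterS hE => x /= h _; rewrite EFinM.
  by apply: lee_wpmul2r => //; rewrite lee_fin.
rewrite lee_fin fine_invr => p1.
have [->|p1'] := eqVneq p 1.
  rewrite invr1 powRr1 ?(ltW M0)// Lnorm1 -ge0_integralZl//; last first.
    by rewrite lee_fin mulr_ge0// ltW.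
  apply: ge0_le_integral => //.
  - by move=> x _; rewrite lee_fin mulr_ge0.
  - by apply: emeasurable_funM => //.
  by move=> x _; rewrite /= -EFinM lee_fin mulrC ler_wpM2r.
have {}p1 : 1 < p by rewrite lt_neqAle eq_sym p1'.
have p0 : 0 < p by apply: lt_trans p1.
pose q := (1 - p^-1)^-1.
have qV : q^-1 = 1 - p^-1 by rewrite invrK.
have q1 : 1 < q.
  by rewrite invf_gt1 ?gtrBl ?invr_gt0// subr_gt0 invf_lt1.
have pE : p^-1 = 1 - q^-1 by rewrite qV opprB addrC subrK.
rewrite pE muleC.
apply: (@le_trans _ _ ('N[mu]_p%:E[EFin \o f] * 'N[mu]_q%:E[EFin \o g])%E); last first.
  by apply: lee_wpmul2l; [exact: Lnorm_ge0|exact: Lnorm_weight_le].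
apply: le_trans (hoelder mu mf mg p0 (lt_trans ltr01 q1) _); last first.
  by rewrite qV addrC subrK.
rewrite Lnorm1; apply: ge0_le_integral => //.
- by move=> x _; rewrite lee_fin mulr_ge0.
- by apply: measurableT_comp => //; apply/measurable_EFinP; exact: measurable_funM.
by move=> x _; rewrite /= lee_fin normrM (ger0_norm (g0 x)).
Qed.

End weighted_Lnorm.

(** * The bound on the Walsh coefficients *)

Section cube_integrals.
Context {R : realType}.
Local Notation RT := (measurableTypeR R).
Local Notation U := (@unif R).

Lemma bmeas_tnth n (phi : 'I_n -> RT -> R) i :
  bmeas (phi i) -> bmeas (fun x : n.-tuple RT => phi i (tnth x i)).
Proof. by move=> b; apply: bmeas_comp b; exact: measurable_tnth. Qed.

Lemma Rintegral_cube_prod n (phi : 'I_n -> RT -> R) :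
  (forall i, bmeas (phi i)) ->
  \int[@cube_prob R n]_x \prod_i phi i (tnth x i) =
  \prod_i \int[U]_t phi i t.
Proof.
move=> bphi.
have bp r : bmeas (fun x : n.-tuple RT => \prod_(i <- r) phi i (tnth x i)).
  by apply: bmeas_prod => i; exact: bmeas_tnth.
suff H r : uniq r -> \int[@cube_prob R n]_x \prod_(i <- r) phi i (tnth x i) =
    \prod_(i <- r) \int[U]_t phi i t.
  exact: H (index_enum_uniq _).
elim: r => [_|i r IH /= /andP[ir ur]].
  under eq_Rintegral do rewrite big_nil.
  by rewrite Rintegral_prob_cst big_nil.
rewrite (Rintegral_cube_upd i (bp (i :: r))) big_cons -(IH ur).
rewrite -bmeas_RintegralZl//; apply: eq_Rintegral => x _.
rewrite -bmeas_RintegralZr//; apply: eq_Rintegral => t _.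
rewrite big_cons tnth_mktuple eqxx; congr (_ * _); apply: eq_big_seq => j jr.
by rewrite tnth_mktuple; case: eqP jr ir => // -> ->.
Qed.

(** Connects the convention of the norm, extension by 0 to the whole space, with [cube_prob]. *)
Lemma integral_restrict_cube n (g : n.-tuple RT -> R) : bmeas g ->
  (\int[lebesgue_tuple n]_x ((g \_ @unit_cube R n) x)%:E =
   (\int[@cube_prob R n]_x g x)%:E)%E.
Proof.
move=> bg; rewrite -(Rintegral_unit_cube bg (fun x _ => erefl)) /Rintegral.
have E : (\int[lebesgue_tuple n]_x ((g \_ @unit_cube R n) x)%:E =
    \int[lebesgue_tuple n]_(x in @unit_cube R n) (g x)%:E)%E.
  rewrite [RHS]integral_mkcond; apply: eq_integral => x _.
  by rewrite !patchE; case: ifP.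
rewrite E fineK// (@eq_measure_integral _ _ _ _ (@cube_prob R n)).
  apply: integrable_fin_num; first exact: measurable_unit_cube.
  apply: integrableS (bmeas_integrable (@cube_prob R n) bg) => //.
  exact: measurable_unit_cube.
by move=> A mA Ac; rewrite /= /cube_prob /mrestr setIidl.
Qed.

Lemma lebesgue_tuple_gt0 n : (0 < lebesgue_tuple n [set: n.-tuple RT])%E.
Proof.
apply: (@lt_le_trans _ _ (@cube_prob R n setT)).
  have -> : @cube_prob R n setT = 1%E := probability_setT (@cube_prob R n).
  by rewrite lte_fin.
rewrite /cube_prob /mrestr setTI; apply: le_measure; rewrite ?inE//.
exact: measurable_unit_cube.
Qed.

Lemma measurable_restrict_cube n (g : n.-tuple RT -> R) : bmeas g ->
  measurable_fun setT (g \_ @unit_cube R n).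
Proof.
move=> [mg _].
exact: (measurable_restrictT g (@measurable_unit_cube R n)).1 (measurable_funTS mg).
Qed.

End cube_integrals.

Lemma tnth_extend0_in s (v : {set 'I_s}) (k : #|v|.-tuple nat) (j : 'I_#|v|) :
  tnth (extend0 k) (enum_val j) = tnth k j.
Proof.
rewrite tnth_mktuple enum_valP (tnth_nth 0%N) /enum_val index_uniq//.
  by rewrite -cardE.
exact: enum_uniq.
Qed.

Lemma tnth_extend0_notin s (v : {set 'I_s}) (k : #|v|.-tuple nat)
    (j : 'I_#|~: v|) :
  tnth (extend0 k) (enum_val j) = 0%N.
Proof. by have := enum_valP j; rewrite inE tnth_mktuple => /negbTE ->. Qed.

Lemma min_alpha_le alpha m : (min_alpha alpha m <= m)%N.
Proof. by case: alpha => //= a; exact: geq_minr. Qed.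

Lemma le_alpha_min alpha m : le_alpha (min_alpha alpha m) alpha.
Proof. by case: alpha => //= a; exact: geq_minl. Qed.

Lemma le_alpha_trans alpha m n : (m <= n)%N -> le_alpha n alpha ->
  le_alpha m alpha.
Proof. by case: alpha => //= a; exact: leq_trans. Qed.

Lemma le_alpha0 alpha : le_alpha 0 alpha.
Proof. by case: alpha. Qed.

Theorem theorem1p3 (R : realType) (s : nat) (alpha : option nat)
    (f : 'rV[R]_s -> R) (p : \bar R) (v : {set 'I_s}) (k : #|v|.-tuple nat) :
  (0 < s)%N ->
  le_alpha 2 alpha ->
  continuous_mixed_partials alpha f ->
  (1 <= p)%E ->
  v != finset.set0 ->
  (forall i, (0 < tnth k i)%N) ->
  (`|walsh_coef f (extend0 k)|%:E <=
     (2 `^ (#|v|%:R * fine p^-1%E) * 2 ^- mu' alpha k)%:E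
     * deriv_norm (min_alphaN alpha k) p f)%E.
Proof.
move=> _ _ cf p1 _ _.
(* In a coordinate of [v], as many exponents are used as [alpha] allows derivatives; the others
   remain as signs, which [walsh_kern_norm] removes. *)
pose N := min_alphaN alpha k; pose n : s.-tuple nat := extend0 N.
pose e (i : 'I_s) := exponents (tnth (extend0 k) i).
have se i : sorted gtn (e i) by exact: exponents_sorted.
have NE (j : 'I_#|v|) : tnth N j = min_alpha alpha (size (exponents (tnth k j))).
  by rewrite tnth_mktuple.
have n_le i : (tnth n i <= size (e i))%N.
  elim/(ord_glue_ind (v := v)): i => j; last by rewrite tnth_extend0_notin.
  by rewrite /e !tnth_extend0_in NE min_alpha_le.
have n_alpha i : le_alpha (tnth n i) alpha.
  elim/(ord_glue_ind (v := v)): i => j.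
    by rewrite tnth_extend0_in NE le_alpha_min.
  by rewrite tnth_extend0_notin le_alpha0.
pose D := mixed_partial n f.
have [hD cD] := cf n n_alpha.
have cf0 : {within @closed_cube R s, continuous f}.
  have [|_] := cf [tuple 0%N | i < s].
    by move=> i; rewrite tnth_mktuple le_alpha0.
  rewrite /mixed_partial (_ : diff_vars _ = [::])//.
  apply/nilP; rewrite /nilp -all_pred0; apply/allP => i.
  by rewrite -has_pred1 has_count count_diff_vars tnth_mktuple.
have bD := bmeas_cube_ext cD.
have bk m := @bmeas_cube_kern R s e m.
pose A (y : #|v|.-tuple (measurableTypeR R)) : R :=
  \int[@cube_prob R #|~: v|]_z cube_ext D (Defs.glue y z).
have bA : bmeas A.
  exact: (bmeas_Rintegral_snd (@cube_prob R _) (@cube_prob R _) (bmeas_glue v bD)).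
pose K (y : #|v|.-tuple (measurableTypeR R)) : R :=
  \prod_j walsh_kern (exponents (tnth k j)) (tnth N j) (tnth y j).
have bK : bmeas K.
  apply: bmeas_prod => j; apply: bmeas_comp (bmeas_walsh_kern _ _).
  exact: measurable_tnth.
have by_parts : `|walsh_coef f (extend0 k)| =
    `|\int[@cube_prob R #|v|]_y (A y * K y)|.
  rewrite /walsh_coef (Rintegral_unit_cube
    (g := fun x => cube_ext f x * cube_kern e (fun=> 0%N) x)); last 2 first.
  - by apply: bmeasM => //; exact: bmeas_cube_ext.
  - move=> x; rewrite inE => x01; rewrite cube_extE//; congr (_ * _).
    by apply: eq_bigr => i _; rewrite walsh1E.
  rewrite (@cube_kern_by_parts_iter _ _ _ se _ (diff_vars n))//; last 2 first.
  - move=> w1 w2 /diff_vars_suffix[m -> mn]; apply: (cf m _).2 => i.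
    exact: le_alpha_trans (mn i) (n_alpha i).
  - by move=> i; rewrite count_diff_vars.
  congr `|_|; rewrite (Rintegral_cube_glue v); last exact: bmeasM.
  apply: eq_Rintegral => y _; rewrite -bmeas_RintegralZr; last first.
    exact: (bmeas_snd (bmeas_glue v bD) y).
  apply: eq_Rintegral => z _; congr (_ * _).
  (* Outside [v] the frequency is 0 and has no exponents, so the factor is 1 and the integral over
     these coordinates falls on the derivative alone. *)
  rewrite /cube_kern (prod_glue v) [X in _ * X]big1 ?mulr1; last first.
    move=> j _; rewrite /e tnth_extend0_notin count_diff_vars tnth_extend0_notin.
    by rewrite /walsh_kern /= big_nil mulr1.
  apply: eq_bigr => j _.
  by rewrite /e tnth_extend0_in count_diff_vars tnth_extend0_in tnth_glue_in.
pose l j := rev (take (tnth N j) (exponents (tnth k j))).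
pose Phi (y : #|v|.-tuple (measurableTypeR R)) : R := \prod_j kern (l j) (tnth y j).
have KE y : `|K y| = Phi y.
  by rewrite normr_prod; apply: eq_bigr => j _; rewrite walsh_kern_norm.
have bPhi : bmeas Phi.
  by rewrite (_ : Phi = fun y => `|K y|); [exact: bmeas_norm|apply/funext => y].
pose c : R := 2 ^- mu' alpha k.
have c0 : 0 < c by exact: pow2V_gt0.
(* Each exponent [a] that is used contributes [2 ^- (a + 2)], and [mu'] sums [a + 2] over the same
   truncated lists. *)
have cE : \prod_j kern_mean (l j) = c.
  rewrite /c /mu' -exprVn (big_morph (fun n => (2^-1 : R) ^+ n) (exprD _) (expr0 _)).
  apply: eq_bigr => j _; rewrite /kern_mean /l.
  rewrite (big_morph (fun n => (2^-1 : R) ^+ n) (exprD _) (expr0 _)).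
  rewrite (perm_big (take (tnth N j) (exponents (tnth k j)))) ?perm_rev//=.
  by apply: eq_bigr => a _; rewrite exprVn.
have IPhi : \int[@cube_prob R #|v|]_y Phi y = c.
  rewrite (Rintegral_cube_prod (fun j => bmeas_kern (l j))) -cE.
  by apply: eq_bigr => j _; rewrite Rintegral_kern.
have Phi0 y : 0 <= Phi y by apply: prodr_ge0 => j _; exact: kern_ge0.
(* One factor 2 per coordinate of [v], whence [M = 2 ^+ #|v|] and the constant of the theorem.
   [kern_le] speaks of [0,1) only, hence the restriction to the cube. *)
have PhiM y : @unit_cube R #|v| y -> Phi y <= 2 ^+ #|v| * c.
  move=> y01; have -> : 2 ^+ #|v| = \prod_(j < #|v|) 2 :> R.
    by rewrite prodr_const card_ord.
  rewrite -cE -big_split/=.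
  apply: ler_prod => j _; rewrite kern_ge0/=; apply: kern_le => //.
  rewrite /l rev_sorted; apply: take_sorted; exact: exponents_sorted.
have powM : (2 ^+ #|v|) `^ (fine p^-1%E) = 2 `^ (#|v|%:R * fine p^-1%E) :> R.
  by rewrite powRrM powR_mulrn.
have normE : deriv_norm N p f =
    'N[lebesgue_tuple #|v|]_p[EFin \o (A \_ @unit_cube R #|v|)]%E.
  rewrite /deriv_norm; congr Lnorm; apply/funext => y; rewrite /= !patchE.
  case: ifPn => // /[!inE] y01; congr EFin.
  apply: Rintegral_unit_cube; first exact: (bmeas_snd (bmeas_glue v bD) y).
  move=> z /[!inE] z01; rewrite cube_extE//.
  by apply: (ord_glue_ind (v := v)) => j; rewrite ?tnth_glue_in ?tnth_glue_notin.
have bAPhi : bmeas (fun y => `|A y| * Phi y).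
  by apply: bmeasM => //; exact: bmeas_norm.
rewrite -powM normE -/c by_parts.
apply: (@le_trans _ _ (\int[@cube_prob R #|v|]_y (`|A y| * Phi y))%:E).
  rewrite lee_fin; apply: le_trans (bmeas_le_normr_Rintegral _ (bmeasM bA bK)) _.
  by under eq_Rintegral do rewrite normrM KE.
rewrite -integral_restrict_cube//.
(* Restricting both factors makes the weight bounded on the whole space, as the weighted inequality
   requires. *)
under eq_integral => y _.
  rewrite (_ : ((fun y => `|A y| * Phi y) \_ _) y =
    `|(A \_ @unit_cube R #|v|) y| * (Phi \_ @unit_cube R #|v|) y); last first.
    by rewrite !patchE; case: ifP => _ //; rewrite mulr0.
  over.
apply: integral_weight_le_Lnorm => //.
- exact: measurable_restrict_cube.
- exact: measurable_restrict_cube.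
- by move=> y; rewrite patchE; case: ifP.
- move=> y; rewrite patchE; case: ifPn => [/[!inE]|_]; first exact: PhiM.
  by rewrite mulr_ge0// ltW.
- by rewrite integral_restrict_cube// IPhi.
- exact: lebesgue_tuple_gt0.
Qed.
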